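(* Let $\eta$ be a max-stable process on $\mathcal{X}$ with the spectral representation given in the context, and let $s_1,s_2\in\mathcal{X}$. Then the extremal concurrence probability satisfies $p(s_1,s_2)=\tau$, where $$\tau=\mathbb{E}\left[\operatorname{sign}\{\eta(s_1)-\eta_*(s_1)\}\,\operatorname{sign}\{\eta(s_2)-\eta_*(s_2)\}\right]$$ is the Kendall's $\tau$ of $\{\eta(s_1),\eta(s_2)\}$ and $\eta_*$ is an independent copy of $\eta$.
   Context: $\mathcal{X}\subset\mathbb{R}^d$, $d\ge1$, is a compact set. Max-stable process: $\eta(s)=\max_{i\ge1}\zeta_iY_i(s)=\max_{\varphi\in\Phi}\varphi(s)$, $s\in\mathcal{X}$, where $\{\zeta_i\colon i\ge1\}$ are the points of a Poisson process on $(0,\infty)$ with intensity $\zeta^{-2}\,d\zeta$, the $Y_i$ are independent copies (independent of $\{\zeta_i\}$) of a non-negative stochastic process $Y$ on $\mathcal{X}$ with continuous sample paths, $\mathbb{E}\{Y(s)\}=1$ for all $s\in\mathcal{X}$ and $\mathbb{E}\{\sup_{s\in\mathcal{X}}Y(s)\}<\infty$; $\Phi=\{\varphi_i=\zeta_iY_i\colon i\ge1\}$. Extremal concurrence probability: $p(s_1,s_2)=\mathbb{P}\{\text{for some }\ell\ge1\colon \eta(s_j)=\varphi_\ell(s_j),\ j=1,2\}$. *)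

(* Defs.v *)
From HB Require Import structures.
From mathcomp Require Import all_boot all_order all_algebra finmap.
From mathcomp Require Import all_classical all_reals all_analysis.
From mathcomp Require Import measurable_realfun.

Set Implicit Arguments.
Unset Strict Implicit.
Unset Printing Implicit Defensive.

Import Order.TTheory GRing.Theory Num.Theory.
Import numFieldNormedType.Exports.

Local Open Scope classical_set_scope.
Local Open Scope ring_scope.

Section families_of_random_variables.
Context {R : realType}.

(* A family Z : I -> T -> E is always paired with the set D of its relevant
   indices; values of Z outside D are junk and never used. *)
Definition measurable_family d d' (T : measurableType d) (E : measurableType d')
    (I : Type) (D : set I) (Z : I -> T -> E) : Prop :=
  forall i, D i -> measurable_fun setT (Z i).

Definition sigma_family d d' (T : measurableType d) (E : measurableType d')
    (I : Type) (D : set I) (Z : I -> T -> E) : set (set T) :=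
  <<s \bigcup_(i in D) preimage_set_system setT (Z i) measurable >>.

Definition independent2 d (T : measurableType d) (P : probability T R)
    (F G : set (set T)) : Prop :=
  forall A B, F A -> G B -> P (A `&` B) = (P A * P B)%E.

Definition mutually_independent d (T : measurableType d) (P : probability T R)
    (I : choiceType) (F : I -> set (set T)) : Prop :=
  forall (J : {fset I}) (A : I -> set T), (forall i, i \in J -> F i (A i)) ->
    P (\bigcap_(i in [set` J]) A i) = (\prod_(i <- J) P (A i))%E.

(* Equality of all finite-dimensional distributions; the two processes may live
   on different probability spaces. *)
Definition same_law d1 d2 (T1 : measurableType d1) (T2 : measurableType d2)
    (P1 : probability T1 R) (P2 : probability T2 R) (I : Type) (D : set I)
    (Z1 : I -> T1 -> R) (Z2 : I -> T2 -> R) : Prop :=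
  forall (n : nat) (t : 'I_n -> I) (B : 'I_n -> set R),
    (forall j, D (t j)) -> (forall j, measurable (B j)) ->
    P1 [set w | forall j, B j (Z1 (t j) w)] =
    P2 [set w | forall j, B j (Z2 (t j) w)].

End families_of_random_variables.

Section poisson_process.
Context {R : realType} d (T : measurableType d) (P : probability T R).
Implicit Types (zeta : nat -> T -> R) (lambda : R -> R) (A E : set R).

(* Points are counted with multiplicity. *)
Definition point_count zeta A (w : T) : \bar R :=
  counting [set i | A (zeta i w)].

Definition mean_measure lambda A : \bar R :=
  (\int[lebesgue_measure]_(x in A) (lambda x)%:E)%E.

(* The Poisson law with mean m, allowing m = 0 (the Dirac mass at 0) and
   m = +oo (the constant +oo). The second argument of [poisson_prob] is a dummy
   on which its value does not depend. *)
Definition poisson_distributed (N : T -> \bar R) (m : \bar R) : Prop :=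
  ((m < +oo)%E -> forall k : nat,
     P [set w | N w = (k%:R)%:E] = poisson_prob (fine m) 0%N [set k]) /\
  (m = +oo%E -> P [set w | N w = +oo%E] = 1%E).

(* (zeta i)_i enumerates, in an arbitrary order, the points of a Poisson process
   on E with infinitely many points and with intensity lambda. *)
Definition poisson_points E lambda zeta : Prop :=
  [/\ measurable_family setT zeta,
      forall i w, E (zeta i w),
      forall A, measurable A -> A `<=` E ->
        poisson_distributed (point_count zeta A) (mean_measure lambda A) &
      forall (n : nat) (A : 'I_n -> set R),
        (forall j, measurable (A j)) -> (forall j, A j `<=` E) ->
        trivIset setT A ->
        mutually_independent P
          (fun j => preimage_set_system setT (point_count zeta (A j))
                                        measurable) ].

End poisson_process.

Section max_stable.
Context {R : realType} d (T : measurableType d) (P : probability T R).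
Context (k : nat) (X : set 'rV[R]_k).

Definition nonneg_continuous_process (Y : 'rV[R]_k -> T -> R) : Prop :=
  [/\ measurable_family X Y,
      forall s w, X s -> 0 <= Y s w &
      forall w, {within X, continuous (fun s => Y s w)} ].

Definition spectral_process (Y : 'rV[R]_k -> T -> R) : Prop :=
  [/\ nonneg_continuous_process Y,
      forall s, X s -> ('E_P[Y s] = 1)%E &
      (\int[P]_w ereal_sup [set (Y s w)%:E | s in X] < +oo)%E ].

Definition spectral_functions (zeta : nat -> T -> R)
    (Y : nat -> 'rV[R]_k -> T -> R) (i : nat) (s : 'rV[R]_k) (w : T) : R :=
  zeta i w * Y i s w.

Definition is_maximum (A : set R) (m : R) : Prop := A m /\ ubound A m.

(* The maximum over the infinitely many spectral functions only exists almost
   surely. *)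
Definition pointwise_maximum (phi : nat -> 'rV[R]_k -> T -> R)
    (eta : 'rV[R]_k -> T -> R) : Prop :=
  measurable_family X eta /\
  {ae P, forall w, forall s, X s ->
     is_maximum (range (fun i => phi i s w)) (eta s w)}.

Definition independent_copies d' (T' : measurableType d')
    (Q : probability T' R) (Y : 'rV[R]_k -> T' -> R)
    (Yi : nat -> 'rV[R]_k -> T -> R) : Prop :=
  [/\ forall i, nonneg_continuous_process (Yi i),
      forall i, same_law P Q X (Yi i) Y &
      mutually_independent P (fun i => sigma_family X (Yi i)) ].

Definition spectral_representation d' (T' : measurableType d')
    (Q : probability T' R) (Y : 'rV[R]_k -> T' -> R)
    (zeta : nat -> T -> R) (Yi : nat -> 'rV[R]_k -> T -> R)
    (eta : 'rV[R]_k -> T -> R) : Prop :=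
  [/\ poisson_points P `]0, +oo[%classic (fun x => x ^- 2) zeta,
      independent_copies Q Y Yi,
      independent2 P (sigma_family setT zeta)
        (sigma_family [set p : nat * 'rV[R]_k | X p.2]
                      (fun p => Yi p.1 p.2)) &
      pointwise_maximum (spectral_functions zeta Yi) eta ].

Definition independent_copy (eta eta' : 'rV[R]_k -> T -> R) : Prop :=
  [/\ measurable_family X eta',
      same_law P P X eta' eta &
      independent2 P (sigma_family X eta) (sigma_family X eta') ].

Definition concurrence_probability (phi : nat -> 'rV[R]_k -> T -> R)
    (eta : 'rV[R]_k -> T -> R) (s1 s2 : 'rV[R]_k) : \bar R :=
  P [set w | exists l, eta s1 w = phi l s1 w /\ eta s2 w = phi l s2 w].

Definition kendall_tau (eta eta' : 'rV[R]_k -> T -> R) (s1 s2 : 'rV[R]_k) :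
    \bar R :=
  ('E_P[fun w =>
     (Num.sg (eta s1 w - eta' s1 w) * Num.sg (eta s2 w - eta' s2 w))%R])%E.

End max_stable.

(* Main.v *)
Require Import Defs.
From HB Require Import structures.
From mathcomp Require Import all_boot all_order all_algebra finmap.
From mathcomp Require Import all_classical all_reals all_analysis.
From mathcomp Require Import measurable_realfun ring lra.
Set Implicit Arguments.
Unset Strict Implicit.
Unset Printing Implicit Defensive.
Import Order.TTheory GRing.Theory Num.Theory.
Import numFieldNormedType.Exports.
Local Open Scope classical_set_scope.
Local Open Scope ring_scope.

(**
The points (zeta_i Y_i(s1), zeta_i Y_i(s2)) form a Poisson process on the quadrant whose
intensity mu satisfies mu(A / 2) = 2 mu(A). What is used of this is the avoidance formula: the
process misses A with probability exp(- mu(A)), so hitting disjoint sets are independent events.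
Discretise the quadrant by a finite grid and take two independent copies of the process. If the
top column and the top row of the union of their occupied cells cross in an empty cell, then the
occupied cells of that column below the crossing and those of that row left of it are
independent, and exchanging the two copies in the column alone flips one sign and keeps the
other: such configurations contribute 0 to Kendall's tau. If the crossing cell is occupied, the
product of the signs is 1 up to ties. Hence tau is, up to the probability of a tie, the
probability that the union is concurrent. By the scaling property the union has the law of the
doubled process, whose grid concurrence tends to p(s1, s2) when the mesh is refined.
*)

(** * Expectations of bounded random variables *)

Section bounded_expectation.
Context {R : realType} d {T : measurableType d} (P : probability T R).

(** In the continuum the crossing argument would condition on the positions of the maxima, that is,
    on null events; on a grid it becomes a finite sum over cells. There the indicator of concurrence
    is a signed sum of avoidance indicators, so avoidance probabilities determine its mean, and no
    joint law of cell counts of the planar process is computed. For the same reason the union of the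
    two copies is never built as a process: it is enough that it avoids a set with the squared
    probability. Multiplying all points by 2 preserves every comparison with the maxima, hence also
    concurrence. The copy [eta'] is known only through its law and its independence of [eta]; it
    enters as a second summation variable carrying the same weights. The total mass of [mu] is
    infinite, so counts may be infinite and avoidance probabilities may vanish. The passage to the
    limit rests on the finiteness of [mu] away from the axes: almost surely only finitely many
    points have a first coordinate above a given positive threshold. *)

Lemma bounded_integrable (f : T -> R) (M : R) : measurable_fun setT f ->
  (forall x, `|f x| <= M) -> P.-integrable setT (EFin \o f).
Proof.
move=> mf fM; apply: measurable_bounded_integrable => //.
  by rewrite (@fin_num_fun_lty _ _ _ P)//; exact: fin_num_measure.
exists M; split; first exact: num_real.
by move=> y My x _ /=; rewrite (le_trans (fM x))// ltW.
Qed.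

Lemma unit_integrable (f : T -> R) : measurable_fun setT f ->
  (forall x, 0 <= f x <= 1) -> P.-integrable setT (EFin \o f).
Proof.
move=> mf f01; apply: (@bounded_integrable _ 1) => // x.
by have /andP[f0 f1] := f01 x; rewrite ger0_norm.
Qed.

Lemma bounded_cvg_Rintegral (f_ : nat -> T -> R) (f : T -> R) (M : R) :
  (forall n, measurable_fun setT (f_ n)) -> measurable_fun setT f ->
  (forall n x, `|f_ n x| <= M) ->
  {ae P, forall x, f_ ^~ x @ \oo --> f x} ->
  \int[P]_x f_ n x @[n --> \oo] --> \int[P]_x f x.
Proof.
move=> mf_ mf fM cf.
have [] := @dominated_convergence _ _ _ P setT measurableT
  (fun n x => (f_ n x)%:E) (EFin \o f) (cst M%:E).
- by move=> n; exact/measurable_EFinP.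
- exact/measurable_EFinP.
- by apply: filterS cf => x cx _; apply: cvg_EFin => //; exact: nearW.
- exact: finite_measure_integrable_cst.
- by apply: aeW => x n _ /=; rewrite lee_fin.
move=> intf _ cfi; apply: fine_cvg.
by rewrite fineK//; exact: integrable_fin_num.
Qed.

Lemma Rintegral_indic (A : set T) : measurable A ->
  \int[P]_x \1_A x = fine (P A).
Proof. by move=> mA; rewrite /Rintegral integral_indic// setIT. Qed.

Lemma Rintegral_sum (I : Type) (s : seq I) (f : I -> T -> R) :
  (forall i, P.-integrable setT (EFin \o f i)) ->
  \int[P]_x (\sum_(i <- s) f i x) = \sum_(i <- s) \int[P]_x f i x.
Proof.
move=> intf; elim: s => [|i s IH].
  by under eq_Rintegral do rewrite big_nil; rewrite big_nil Rintegral_cst// mul0r.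
under eq_Rintegral do rewrite big_cons.
rewrite big_cons RintegralD//; first by rewrite IH.
have : P.-integrable setT (fun x => \sum_(i <- s) (f i x)%:E)%E.
  by apply: integrable_sum => // j _; exact: intf.
by apply: eq_integrable => // x _ /=; rewrite sumEFin.
Qed.

Lemma Rintegral_simple (I : finType) (a : I -> R) (S : I -> set T) :
  (forall i, measurable (S i)) ->
  \int[P]_x (\sum_i a i * \1_(S i) x) = \sum_i a i * fine (P (S i)).
Proof.
move=> mS.
have intS i : P.-integrable setT (EFin \o \1_(S i)).
  by apply: unit_integrable => // x; rewrite indicE; case: (_ \in _); rewrite ler01 lexx.
rewrite Rintegral_sum => [|i]; last first.
  apply: (@bounded_integrable _ `|a i|) => // [|x];
    [exact: measurable_funM|rewrite normrM indicE].
  by case: (_ \in _); rewrite ?normr1 ?mulr1// normr0 mulr0.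
by apply: eq_bigr => i _; rewrite RintegralZl// Rintegral_indic.
Qed.

End bounded_expectation.

(** * Rounding down to multiples of 1/(n+1) *)

Section floor_approximation.
Context {R : realType}.

Definition floor_approx (n : nat) (x : R) : R :=
  (Num.truncn (n.+1%:R * x))%:R / n.+1%:R.

(** The indices go up to [n.+1] because the value 1 has a level of its own. *)
Definition floor_level d {T : measurableType d} (n : nat) (f : T -> R)
    (a : 'I_n.+2) : set T :=
  f @^-1` `[a%:R / n.+1%:R, a.+1%:R / n.+1%:R[.

Lemma floor_approx_ge0 n x : 0 <= floor_approx n x.
Proof. by rewrite divr_ge0. Qed.

Lemma floor_approx_le n x : 0 <= x -> floor_approx n x <= x.
Proof. by move=> x0; rewrite ler_pdivrMr// mulrC truncn_le mulr_ge0. Qed.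

Lemma floor_approx_gt n x : x - n.+1%:R^-1 < floor_approx n x.
Proof.
rewrite /floor_approx ltrBlDr -[X in _ + X]mul1r -mulrDl ltr_pdivlMr//.
by rewrite mulrC natr1 truncnS_gt.
Qed.

Lemma cvg_floor_approx x : 0 <= x -> floor_approx n x @[n --> \oo] --> x.
Proof.
move=> x0; apply: (@squeeze_cvgr _ _ _ _ (fun n => x - n.+1%:R^-1) (fun=> x)).
- by near=> n; rewrite floor_approx_le// ltW// floor_approx_gt.
- rewrite -[X in _ --> X]subr0; apply: cvgB; first exact: cvg_cst.
  exact: cvg_harmonic.
- exact: cvg_cst.
Unshelve. all: by end_near. Qed.

Lemma floor_levelP d {T : measurableType d} n (f : T -> R) (a : 'I_n.+2) x :
  0 <= f x -> (x \in floor_level f a) = (a == Num.truncn (n.+1%:R * f x) :> nat).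
Proof.
move=> f0; rewrite /floor_level; apply/idP/idP.
  rewrite inE /= in_itv/= ler_pdivrMr// ltr_pdivlMr// mulrC => /truncn_def <-.
  exact: eqxx.
move=> /eqP ax; rewrite inE /= in_itv/= ler_pdivrMr// ltr_pdivlMr// mulrC ax.
by rewrite truncn_itv// mulr_ge0.
Qed.

Lemma floor_approxE d {T : measurableType d} n (f : T -> R) x :
  0 <= f x <= 1 ->
  floor_approx n (f x) = \sum_(a < n.+2) a%:R / n.+1%:R * \1_(floor_level f a) x.
Proof.
move=> /andP[f0 f1].
have ltn : (Num.truncn (n.+1%:R * f x) < n.+2)%N.
  rewrite truncn_lt_nat ?mulr_ge0//.
  by rewrite (@le_lt_trans _ _ n.+1%:R)// ?ltr_nat// ler_piMr.
rewrite (bigD1 (Ordinal ltn))//= indicE floor_levelP// eqxx mulr1.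
rewrite big1 ?addr0// => i /negPf iN; rewrite indicE floor_levelP//.
by move: iN; rewrite -val_eqE /= => ->; rewrite mulr0.
Qed.

Lemma measurable_floor_level d {T : measurableType d} n (f : T -> R) (a : 'I_n.+2) :
  measurable_fun setT f -> measurable (floor_level f a).
Proof.
by move=> mf; rewrite -[X in measurable X]setTI; exact: mf.
Qed.

Lemma measurable_floor_approx d {T : measurableType d} n (f : T -> R) :
  measurable_fun setT f -> (forall x, 0 <= f x <= 1) ->
  measurable_fun setT (fun x => floor_approx n (f x)).
Proof.
move=> mf f01; rewrite [X in measurable_fun _ X](_ : _ =
  fun x => \sum_(a < n.+2) a%:R / n.+1%:R * \1_(floor_level f a) x); last first.
  by apply/funext => x; rewrite floor_approxE.
apply: measurable_sum => a; apply: measurable_funM => //.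
by apply: measurable_indic; exact: measurable_floor_level.
Qed.

End floor_approximation.

(** * Expectation of a product of independent variables *)

Section product_of_independent.
Context {R : realType} d {T : measurableType d} (P : probability T R).
Context d' {E : measurableType d'}.

(** The rounded functions are finite combinations of indicators: distributing the product over all
    choices of levels leaves probabilities of intersections, which factorise by hypothesis. Bounded
    convergence then removes the rounding. *)
Lemma Rintegral_prod_independent n (N : 'I_n -> T -> E) (f : 'I_n -> E -> R) :
  (forall i, measurable_fun setT (N i)) ->
  (forall B : 'I_n -> set E, (forall i, measurable (B i)) ->
    P (\bigcap_i (N i @^-1` B i)) = (\prod_i P (N i @^-1` B i))%E) ->
  (forall i, measurable_fun setT (f i)) -> (forall i x, 0 <= f i x <= 1) ->
  \int[P]_w (\prod_i f i (N i w)) = \prod_i \int[P]_w f i (N i w).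
Proof.
move=> mN indN mf f01.
have mNpre i B : measurable B -> measurable (N i @^-1` B).
  by move=> mB; rewrite -[X in measurable X]setTI; exact: mN.
have mfN i : measurable_fun setT (f i \o N i) by exact: measurableT_comp.
pose phi m i w := floor_approx m (f i (N i w)).
have phi01 m i w : 0 <= phi m i w <= 1.
  rewrite floor_approx_ge0; have /andP[f0 f1] := f01 i (N i w).
  by rewrite (le_trans (floor_approx_le _ _)).
have mphi m i : measurable_fun setT (phi m i).
  by apply: (measurable_floor_approx _ (f:=f i \o N i)) => // x; exact: f01.
have prod01 (g : 'I_n -> R) : (forall i, 0 <= g i <= 1) -> `|\prod_i g i| <= 1.
  move=> g01; rewrite ger0_norm; last by apply: prodr_ge0 => i _; case/andP: (g01 i).
  by apply: prodr_ile1 => i _; exact: g01.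
have stepE m : \int[P]_w (\prod_i phi m i w) = \prod_i \int[P]_w phi m i w.
  pose S i (a : 'I_m.+2) : set E := floor_level (f i) a.
  have mS i a : measurable (S i a) by exact: measurable_floor_level.
  have phiE i w : phi m i w = \sum_(a < m.+2) a%:R / m.+1%:R * \1_(N i @^-1` S i a) w.
    by rewrite /phi floor_approxE.
  under eq_Rintegral => w _.
    under eq_bigr do rewrite phiE.
    rewrite bigA_distr_bigA/=.
    under eq_bigr => k _.
      rewrite big_split/=.
      rewrite (_ : \prod_(i < n) \1_(N i @^-1` S i (k i)) w =
                   \1_(\bigcap_i (N i @^-1` S i (k i))) w); last first.
        rewrite indicE; case: (boolP (w \in _)) => [|]; rewrite ?notin_setE ?inE => wk.
          rewrite big1// => i _; rewrite indicE mem_set//; exact: wk.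
        have /existsNP[i wi] : ~ forall i, (N i @^-1` S i (k i)) w.
          by move=> h; apply: wk => i _; exact: h.
        by rewrite (bigD1 i)//= indicE memNset// mul0r.
      over.
    over.
  rewrite Rintegral_simple; last first.
    by move=> k; apply: fin_bigcap_measurable => // i _; exact: mNpre.
  under [in RHS]eq_bigr => i _.
    under eq_Rintegral do rewrite phiE.
    rewrite Rintegral_simple; last by move=> a; exact: mNpre.
    over.
  rewrite bigA_distr_bigA/=; apply: eq_bigr => k _.
  rewrite [RHS]big_split/=; congr (_ * _).
  rewrite indN// -[RHS]/(fine (_ %:E)); congr fine.
  rewrite -prodEFin; apply: eq_bigr => i _.
  by rewrite fineK// fin_num_measure//; exact: mNpre.
have cphi i w : phi m i w @[m --> \oo] --> f i (N i w).
  by apply: cvg_floor_approx; case/andP: (f01 i (N i w)).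
have cl : \int[P]_w (\prod_i phi m i w) @[m --> \oo] --> \int[P]_w (\prod_i f i (N i w)).
  apply: (@bounded_cvg_Rintegral _ _ _ _ _ _ 1).
  - by move=> m; apply: measurable_prod => i _; exact: mphi.
  - by apply: measurable_prod => i _; exact: mfN.
  - by move=> m w; apply: prod01 => i; exact: phi01.
  - apply: aeW => w; apply: cvg_big => //.
    by move=> x; exact: mul_continuous.
have cr : \prod_i \int[P]_w phi m i w @[m --> \oo] --> \prod_i \int[P]_w f i (N i w).
  apply: cvg_big => //; first by move=> x; exact: mul_continuous.
  move=> i _; apply: (@bounded_cvg_Rintegral _ _ _ _ _ _ 1) => //.
  - exact: mfN.
  - by move=> m w; have /andP[p0 p1] := phi01 m i w; rewrite ger0_norm.
  - by apply: aeW => w; exact: cphi.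
move: cl; rewrite (_ : (fun m => _) = (fun m => \prod_i \int[P]_w phi m i w)); last exact/funext.
by move=> cl; have := cvg_unique _ cl cr; apply.
Qed.

End product_of_independent.

(** * Laplace functional of the Poisson process *)

Section poisson_pgf.
Context {R : realType}.
Local Open Scope ereal_scope.

(* [c ^ x] for a count [x], with value 0 at [+oo] (and at junk, non-natural arguments); as a
   series its measurability and its integral are immediate. *)
Definition pow_count (c : R) (x : \bar R) : \bar R :=
  \sum_(k <oo) (c ^+ k)%:E * (\1_[set k%:R%:E : \bar R] x)%:E.

Lemma pow_count_nat c n : (0 <= c)%R -> pow_count c n%:R%:E = (c ^+ n)%:E.
Proof.
move=> c0; rewrite /pow_count (@nneseriesD1 _ _ n)//; last first.
  by move=> k _; rewrite -EFinM lee_fin mulr_ge0 ?exprn_ge0// indicE; case: (_ \in _).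
rewrite indicE mem_set//= mule1 eseries0 ?adde0// => k _ /= kn.
rewrite indicE memNset ?mule0//= => -[] /eqP.
by rewrite eqr_nat eq_sym (negbTE kn).
Qed.

Lemma pow_county c : pow_count c +oo = 0.
Proof.
by rewrite /pow_count eseries0// => k _ _; rewrite indicE memNset ?mule0.
Qed.

Lemma pow_count_ge0 c x : (0 <= c)%R -> 0 <= pow_count c x.
Proof.
move=> c0; apply: nneseries_ge0 => k _ _.
by rewrite -EFinM lee_fin mulr_ge0 ?exprn_ge0// indicE; case: (_ \in _).
Qed.

Lemma pow_count_le1 c x : (0 <= c <= 1)%R -> pow_count c x <= 1.
Proof.
move=> /andP[c0 c1].
have [[n ->]|xN] := pselect (exists n, x = n%:R%:E).
  by rewrite pow_count_nat// lee_fin exprn_ile1.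
rewrite /pow_count eseries0// => k _ _.
by rewrite indicE memNset ?mule0//= => xk; apply: xN; exists k.
Qed.

Lemma measurable_pow_count c : (0 <= c)%R -> measurable_fun setT (pow_count c).
Proof.
move=> c0; apply: (@ge0_emeasurable_sum _ _ _ _ _ predT) => [k x _ _|k _].
  by rewrite -EFinM lee_fin mulr_ge0 ?exprn_ge0// indicE; case: (_ \in _).
apply: emeasurable_funM; first exact: measurable_cst.
by apply/measurable_EFinP; exact: measurable_indic.
Qed.

Lemma poisson_prob_set1 (r : R) n k : (0 <= r)%R ->
  poisson_prob r n [set k] = (expR (- r) * (k`!%:R^-1 * r ^+ k))%:E.
Proof.
rewrite le_eqVlt => /orP[/eqP <-|r0]; rewrite /poisson_prob.
  rewrite ltxx diracE oppr0 expR0 mul1r expr0n.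
  case: k => [|k]; first by rewrite mem_set//= fact0 invr1 mulr1.
  by rewrite memNset ?mulr0//=.
rewrite r0 esum_set1 ?lee_fin ?poisson_pmf_ge0// /poisson_pmf r0.
by rewrite mulrC [(r ^+ k * _)%R]mulrC.
Qed.

Lemma nneseries_exp_coeff (x : R) : (0 <= x)%R ->
  \sum_(k <oo) (k`!%:R^-1 * x ^+ k)%:E = (expR x)%:E.
Proof.
move=> x0; rewrite expRE -EFin_lim; last first.
  rewrite /pseries/=; under eq_fun do rewrite mulrC.
  exact: is_cvg_series_exp_coeff.
by apply/congr_lim/funext => n/=; rewrite /pseries/= /series/= -sumEFin.
Qed.

Context d {T : measurableType d} (P : probability T R).

Let measurable_count_indic (N : T -> \bar R) k : measurable_fun setT N ->
  measurable_fun setT (fun w => (\1_[set k%:R%:E : \bar R] (N w))%:E : \bar R).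
Proof.
move=> mN; apply: measurableT_comp => //; apply: (measurableT_comp _ mN).
by apply: measurable_indic; exact: emeasurable_set1.
Qed.

Lemma integral_pow_count (c : R) (N : T -> \bar R) : (0 <= c)%R ->
  measurable_fun setT N ->
  \int[P]_w pow_count c (N w) =
  \sum_(k <oo) (c ^+ k)%:E * P [set w | N w = k%:R%:E].
Proof.
move=> c0 mN; rewrite integral_nneseries//; last 2 first.
- move=> k; apply: emeasurable_funM; first exact: measurable_cst.
  exact: measurable_count_indic.
- by move=> k x _; rewrite -EFinM lee_fin mulr_ge0 ?exprn_ge0// indicE; case: (_ \in _).
apply: eq_eseriesr => k _.
have mk : measurable [set w | N w = k%:R%:E].
  rewrite -[X in measurable X]setTI.
  by apply: (mN measurableT [set k%:R%:E]); exact: emeasurable_set1.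
rewrite ge0_integralZl ?lee_fin ?exprn_ge0//; last exact: measurable_count_indic.
congr (_ * _); rewrite -(setIT [set w | N w = _]) -integral_indic//.

Qed.

(** The probability generating function of the Poisson law. For [m = +oo] the count is almost surely
    infinite and both sides vanish; [c = 1] has to be excluded there, since the right-hand side
    would be 1. *)
Lemma poisson_pow_count (c : R) (N : T -> \bar R) (m : \bar R) :
  (0 <= c < 1)%R -> 0 <= m -> measurable_fun setT N ->
  poisson_distributed P N m ->
  \int[P]_w pow_count c (N w) = expeR (- (m * (1 - c)%:E)).
Proof.
move=> /andP[c0 c1] m0 mN [finP infP]; rewrite integral_pow_count//.
have mk x : measurable [set w | N w = x].
  rewrite -[X in measurable X]setTI.
  by apply: (mN measurableT [set x]); exact: emeasurable_set1.
move: m m0 finP infP => [r| |//]; last first.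
  move=> _ _ /(_ erefl) P1.
  rewrite gt0_mulye ?lte_fin ?subr_gt0//= eseries0// => k _ _.
  have -> : P [set w | N w = k%:R%:E] = 0; last by rewrite mule0.
  apply/eqP; rewrite eq_le measure_ge0 andbT.
  have : P (~` [set w | N w = +oo]) = 0 by rewrite probability_setC// P1 subee.
  move=> <-; apply: le_measure; rewrite ?inE//; first exact: measurableC.
  by move=> w /= ->.
rewrite lee_fin => r0 /(_ (ltry _)) finP _.
transitivity (\sum_(k <oo) (expR (- r))%:E * (k`!%:R^-1 * (c * r) ^+ k)%:E).
  apply: eq_eseriesr => k _; rewrite finP poisson_prob_set1// -!EFinM; congr EFin.
  by rewrite /= exprMn; ring.
rewrite nneseriesZl/=; last first.
  by move=> k _; rewrite lee_fin mulr_ge0 ?invr_ge0// exprn_ge0// mulr_ge0.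
rewrite nneseries_exp_coeff ?mulr_ge0// -EFinM -expRD; congr (expR _)%:E.
by ring.
Qed.

End poisson_pgf.

(** * Counts of the first points and their limit *)

Section point_counts.
Context {R : realType} {E : Type}.

Definition hits (zeta : nat -> E) (A : set E) (k : nat) : nat :=
  \sum_(i < k) (zeta i \in A).

Lemma cvg_hits (zeta : nat -> E) (A : set E) :
  (hits zeta A k)%:R%:E @[k --> \oo] --> (counting [set i | A (zeta i)] : \bar R).
Proof.
rewrite counting_dirac.
have : cvgn (fun k : nat => \sum_(0 <= i < k) \d_i [set i | A (zeta i)] : \bar R)%E.
  exact: is_cvg_nneseries.
rewrite (_ : (fun k : nat => _) = (fun k => (hits zeta A k)%:R%:E)) => [//|].
apply/funext => k; rewrite /hits big_mkord natr_sum -sumEFin.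
apply: eq_bigr => i _; rewrite diracE; congr (_ %:R)%:E.
Qed.

(** A finite limit of natural numbers is reached after finitely many steps. An infinite one makes
    the powers of [c < 1] tend to 0, which is the value of [pow_count] at [+oo]. *)
Lemma cvg_pow_hits (c : R) (zeta : nat -> E) (A : set E) : 0 <= c < 1 ->
  (c ^+ hits zeta A k)%:E @[k --> \oo] -->
  pow_count c (counting [set i | A (zeta i)]).
Proof.
move=> /andP[c0 c1]; have := @cvg_hits zeta A.
have : (0 <= (counting [set i | A (zeta i)] : \bar R))%E.
  exact: measure_ge0.
case: (counting _ : \bar R) => [r| |//] _.
  (* Two natural numbers within distance less than 1/2 of the same real coincide. *)
  move=> /fine_cvgP[_ hr]; have /cvgrPdist_lt/(_ 2^-1) := hr.
  rewrite invr_gt0 ltr0n => /(_ isT)[K _ Kr].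
  have hK k : (K <= k)%N -> hits zeta A k = hits zeta A K.
    move=> Kk; have := Kr k Kk; have := Kr K (leqnn K).
    rewrite /= !ltr_norml => /andP[a1 a2] /andP[b1 b2].
    by case: (ltngtP (hits zeta A k) (hits zeta A K)) => //;
      rewrite -(ler_nat R) -natr1 => ?; exfalso; lra.
  have rE : r = (hits zeta A K)%:R.
    apply: (cvg_unique _ hr) => //.
    by apply: cvg_near_cst; exists K => // k /= Kk; rewrite hK.
  rewrite rE pow_count_nat//.
  by apply: cvg_near_cst; exists K => // k /= Kk; rewrite hK.
move=> /cvgeyPge hy; rewrite pow_county.
have : hits zeta A k @[k --> \oo] --> \oo.
  apply/cvgnyPge => M; have := hy M%:R; apply: filterS => k.
  by rewrite lee_fin ler_nat.
move=> hoo; apply: cvg_EFin; first exact: nearW.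
have : geometric 1 c n @[n --> \oo] --> 0 by apply: cvg_geometric; rewrite ger0_norm.
move=> /(cvg_comp (hits zeta A) _ hoo); apply: cvg_trans.
rewrite (_ : geometric 1 c \o _ = (fun k => c ^+ hits zeta A k))//.
by apply/funext => k /=; rewrite /geometric/= mul1r.
Qed.

End point_counts.

Section mutual_independence.
Context {R : realType} d {T : measurableType d} (P : probability T R).

(** Independence is stated over finite sets of indices; this form, with products over ordinals,
    serves the counts of disjoint levels and the first [n] marks. *)
Lemma mutually_independent_ord (I : choiceType) (F : I -> set (set T)) n
    (e : 'I_n -> I) (A : 'I_n -> set T) : injective e ->
  mutually_independent P F -> (forall j, F (e j) (A j)) ->
  P (\bigcap_j A j) = (\prod_j P (A j))%E.
Proof.
move=> inje indF FA.
pose A' i := if [pick j | e j == i] is Some j then A j else setT.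
have A'e j : A' (e j) = A j.
  rewrite /A'; case: pickP => [j' /eqP/inje -> //|/(_ j)].
  by rewrite eqxx.
have := indF [fset e j | j in 'I_n]%fset A'.
rewrite big_imfset/=; last by move=> ? ? _ _; exact: inje.
rewrite big_enum/= => h; under eq_bigr do rewrite -A'e; move: h.
move=> <-; last by move=> i /imfsetP[j _ ->]; rewrite A'e; exact: FA.
congr (P _); rewrite eqEsubset; split=> w wA i /=.
  by move=> /imfsetP[j _ ->]; rewrite A'e; exact: wA.
by move=> _; rewrite -A'e; apply: wA => /=; apply/imfsetP; exists i.
Qed.

End mutual_independence.

(** * The intensity of the points on the half-line *)

Section inverse_square.
Context {R : realType}.

Lemma continuous_inv2 (x : R) : 0 < x -> {for x, continuous (fun y : R => y ^- 2)}.
Proof.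
move=> x0; apply: cvgV; first by rewrite expf_neq0// gt_eqF.
exact: exprn_continuous.
Qed.

Lemma measurable_inv2 : measurable_fun (`]0, +oo[%classic : set R) (fun x : R => x ^- 2).
Proof.
apply: open_continuous_measurable_fun; first exact: interval_open.
by move=> x; rewrite inE/= in_itv/= andbT => /continuous_inv2.
Qed.

(** Level 0 may have infinite mean measure; its term is then [+oo * 0], which is 0 as the integral
    requires. *)
Lemma integral_floor_level n (g : R -> R) : measurable_fun setT g ->
  (forall x, 0 <= g x <= 1) ->
  (\int[lebesgue_measure]_(x in `]0%R, +oo[) (floor_approx n (g x) * x ^- 2)%:E =
   \sum_(a < n.+2) mean_measure (fun x => x ^- 2) (floor_level g a `&` `]0%R, +oo[%classic) *
     (a%:R / n.+1%:R)%:E)%E.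
Proof.
move=> mg g01; pose D : set R := `]0, +oo[%classic.
have mD : measurable D by exact: measurable_itv.
transitivity (\int[lebesgue_measure]_(x in D)
   \sum_(a < n.+2) ((x ^- 2 * \1_(floor_level g a) x)%:E * (a%:R / n.+1%:R)%:E))%E.
  apply: eq_integral => x _; rewrite floor_approxE// mulr_suml -sumEFin.
  by apply: eq_bigr => a _; rewrite -EFinM; congr EFin; ring.
have mf (a : 'I_n.+2) : measurable_fun D (fun x => (x ^- 2 * \1_(floor_level g a) x)%:E).
  apply/measurable_EFinP; apply: measurable_funM; first exact: measurable_inv2.
  by apply: measurable_funTS; apply: measurable_indic; exact: measurable_floor_level.
have f0 (a : 'I_n.+2) x : D x -> (0 <= (x ^- 2 * \1_(floor_level g a) x)%:E)%E.
  by move=> _; rewrite lee_fin mulr_ge0// ?invr_ge0 ?sqr_ge0// indicE; case: (_ \in _).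
rewrite ge0_integral_sum//; last 2 first.
- by move=> a; apply: emeasurable_funM; [exact: mf|exact: measurable_cst].
- by move=> a x Dx; rewrite mule_ge0 ?f0// lee_fin divr_ge0.
apply: eq_bigr => a _; rewrite ge0_integralZr// ?lee_fin ?divr_ge0//; [|exact: mf|exact: f0].
congr (_ * _)%E; rewrite /mean_measure setIC integral_mkcondr.
apply: eq_integral => x _; rewrite patchE indicE.
by case: (x \in _); rewrite ?mulr1 ?mulr0.
Qed.

End inverse_square.

Section laplace_functional.
Context {R : realType} d {T : measurableType d} (P : probability T R).
Variable zeta : nat -> T -> R.
Hypothesis hzeta : poisson_points P `]0, +oo[%classic (fun x => x ^- 2) zeta.

Let mzeta i : measurable_fun setT (zeta i).
Proof. by have [mz _ _ _] := hzeta; exact: mz. Qed.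

Let zeta_gt0 i w : 0 < zeta i w.
Proof. by have [_ /(_ i w)] := hzeta; rewrite /= in_itv/= andbT. Qed.

Lemma measurable_point_count (A : set R) : measurable A ->
  measurable_fun setT (point_count zeta A : T -> \bar R).
Proof.
move=> mA; apply: (@emeasurable_fun_cvg _ _ _ _
  (fun k w => (hits (zeta ^~ w) A k)%:R%:E)) => [k|w _]; last exact: cvg_hits.
apply/measurable_EFinP.
rewrite (_ : (fun w => _) = fun w => \sum_(i < k) \1_A (zeta i w)); last first.
  by apply/funext => w; rewrite /hits natr_sum.
apply: measurable_sum => i; apply: (measurableT_comp _ (mzeta i)).
exact: measurable_indic.
Qed.


Let D : set R := `]0, +oo[%classic.
Let mD : measurable D. Proof. exact: measurable_itv. Qed.

(** Grouping the points by the level of [g] turns the product into powers of the constants [c a],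
    with counts of disjoint sets as exponents. These counts are independent Poisson variables, so
    the limit is a product of generating functions. *)
Lemma laplace_floor n (g : R -> R) : measurable_fun setT g ->
  (forall x, 0 <= g x <= 1) ->
  \int[P]_w (\prod_(i < k) (1 - floor_approx n (g (zeta i w)))) @[k --> \oo] -->
  fine (expeR (- \int[lebesgue_measure]_(x in `]0%R, +oo[)
                   (floor_approx n (g x) * x ^- 2)%:E)).
Proof.
move=> mg g01.
pose A (a : 'I_n.+2) := floor_level g a `&` D.
have mA a : measurable (A a) by apply: measurableI => //; exact: measurable_floor_level.
have AD a : A a `<=` D by move=> x [].
have tA : trivIset setT A.
  apply/trivIsetP => a b _ _ ab; rewrite -subset0 => x [[xa _] [xb _]].
  have g0 : 0 <= g x by case/andP: (g01 x).
  move: ab; rewrite -val_eqE/=.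
  move/mem_set: xa; rewrite floor_levelP// => /eqP ->.
  by move/mem_set: xb; rewrite floor_levelP// => /eqP ->; rewrite eqxx.
pose c (a : 'I_n.+2) : R := 1 - a%:R / n.+1%:R.
have c01 a : 0 <= c a <= 1.
  rewrite /c subr_ge0 ler_pdivrMr// mul1r ler_nat -ltnS ltn_ord/=.
  by rewrite lerBlDr lerDl divr_ge0.
have clt1 (a : 'I_n.+2) : a != 0 :> nat -> c a < 1.
  by move=> a0; rewrite /c ltrBlDr ltrDl divr_gt0// ltr0n lt0n.
(* At level 0 the base is 1 and the count may be infinite, where [pow_count] would give 0 instead of
   the limit 1. *)
pose f (a : 'I_n.+2) (x : \bar R) := if a == 0 :> nat then 1 else fine (pow_count (c a) x).
have f01 a x : 0 <= f a x <= 1.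
  rewrite /f; case: ifPn => _; first by rewrite ler01 lexx.
  have /andP[c0 c1] := c01 a.
  have := pow_count_ge0 x c0; have := pow_count_le1 x (c01 a).
  by case: (pow_count _ _) => //= r; rewrite !lee_fin => -> ->.
have mf a : measurable_fun setT (f a).
  rewrite /f; case: (_ == _ :> nat); first exact: measurable_cst.
  apply: measurableT_comp; first exact: fine_measurable.
  by apply: measurable_pow_count; case/andP: (c01 a).
pose N a := point_count zeta (A a) : T -> \bar R.
have mN a : measurable_fun setT (N a) by exact: measurable_point_count.
have prodE k w : \prod_(i < k) (1 - floor_approx n (g (zeta i w))) =
    \prod_a c a ^+ hits (zeta ^~ w) (A a) k.
  rewrite /hits; under [in RHS]eq_bigr do rewrite expr_sum.
  rewrite [RHS]exchange_big/=; apply: eq_bigr => i _.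
  have /andP[g0 g1] := g01 (zeta i w).
  have ltn : (Num.truncn (n.+1%:R * g (zeta i w)) < n.+2)%N.
    rewrite truncn_lt_nat ?mulr_ge0//.
    by rewrite (@le_lt_trans _ _ n.+1%:R)// ?ltr_nat// ler_piMr.
  have AE a : (zeta i w \in A a) = (a == Num.truncn (n.+1%:R * g (zeta i w)) :> nat).
    rewrite /A in_setI floor_levelP// andb_idr// => _.
    by rewrite inE/= /D/= in_itv/= zeta_gt0.
  rewrite (bigD1 (Ordinal ltn))//= AE eqxx expr1 big1 ?mulr1// => a.
  by rewrite -val_eqE/= AE => /negPf ->; rewrite expr0.
have cvgf a w : c a ^+ hits (zeta ^~ w) (A a) k @[k --> \oo] --> f a (N a w).
  rewrite /f; case: ifPn => [/eqP a0|/clt1 c1].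
    by apply: cvg_near_cst; apply: nearW => k; rewrite /c a0 mul0r subr0 expr1n.
  have /andP[c0 _] := c01 a.
  have := @cvg_pow_hits _ _ (c a) (zeta ^~ w) (A a); rewrite c0 c1 => /(_ isT).
  have := pow_count_ge0 (N a w) c0; have := pow_count_le1 (N a w) (c01 a).
  by rewrite /N /point_count; case: (pow_count _ _) => [r| |]//= _ _ /fine_cvgP[].
have mprod k : measurable_fun setT (fun w => \prod_(i < k) (1 - floor_approx n (g (zeta i w)))).
  apply: measurable_prod => i _; apply: measurable_funB => //.
  apply: (measurable_floor_approx _ (f:=g \o zeta i)).
    exact: measurableT_comp.
  by move=> x; exact: g01.
rewrite [X in _ --> X](_ : _ = \int[P]_w \prod_a f a (N a w)); last first.
  have [_ _ hpois hind] := hzeta.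
  rewrite Rintegral_prod_independent//; last first.
    move=> B mB; apply: (mutually_independent_ord (e:=id) _ (hind _ A mA AD tA)) => // j.
    by exists (B j) => //; rewrite setTI.
  rewrite integral_floor_level//.
  pose m a := mean_measure (fun x : R => x ^- 2) (A a).
  have m0 a : (0 <= m a)%E.
    by apply: integral_ge0 => x _; rewrite lee_fin invr_ge0 sqr_ge0.
  have EE a : expeR (- (m a * (a%:R / n.+1%:R)%:E)) = (\int[P]_w f a (N a w))%:E.
    have [a0|a0] := eqVneq (a : nat) 0%N.
      have -> : f a = fun=> 1 by rewrite /f a0 eqxx.
      rewrite a0 mul0r mule0 oppe0 expeR0 Rintegral_cst// mul1r.
      rewrite -[LHS]/(fine 1%E)%:E; congr (fine _)%:E.
      exact/esym/probability_setT.
    have fE : f a = fun x => fine (pow_count (c a) x) by rewrite /f (negbTE a0).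
    have /andP[c0 _] := c01 a.
    rewrite (_ : a%:R / _ = 1 - c a); last by rewrite /c; ring.
    rewrite -(@poisson_pow_count _ _ _ P (c a) (N a) (m a))//; last 2 first.
    - by rewrite c0 clt1.
    - exact: hpois.
    rewrite /Rintegral fineK//.
      apply: eq_integral => w _; rewrite fE fineK// ge0_fin_numE ?pow_count_ge0//.
      by rewrite (le_lt_trans (pow_count_le1 _ (c01 a)))// ltry.
    apply: integrable_fin_num => //.
    apply: (@unit_integrable _ _ _ P (f a \o N a)) => [|w]; last exact: f01.
    exact: measurableT_comp.
  rewrite -[RHS]/(fine (_%:E)) -prodEFin; congr fine.
  under [in RHS]eq_bigr do rewrite -EE.
  rewrite -/m.
  have /(_ (index_enum _)) : forall s : seq 'I_n.+2,
      expeR (- (\sum_(a <- s) m a * (a%:R / n.+1%:R)%:E)) =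
      (\prod_(a <- s) expeR (- (m a * (a%:R / n.+1%:R)%:E)))%E.
    elim=> [|a s IH]; first by rewrite !big_nil oppe0 expeR0.
    rewrite !big_cons -IH -expeRD oppeD//.
    apply: ge0_adde_def; rewrite inE ?sume_ge0// => *;
      by rewrite mule_ge0// lee_fin divr_ge0.
  exact.
apply: (@bounded_cvg_Rintegral _ _ _ _ _ _ 1) => //.
- by apply: measurable_prod => a _; exact: measurableT_comp.
- move=> k w; rewrite prodE ger0_norm.
    apply: prodr_ile1 => a _; have /andP[c0 c1] := c01 a.
    by rewrite exprn_ge0// exprn_ile1.
  by apply: prodr_ge0 => a _; have /andP[c0 c1] := c01 a; rewrite exprn_ge0.
- apply: aeW => w; under eq_fun do rewrite prodE.
  by apply: cvg_big => //; move=> x; exact: mul_continuous.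
Qed.

(* The bound [b g <= a g k] and the monotonicity in [k] reduce the claim to [L <= b g], which
   follows from [L <= b (gn n)] by Fatou's lemma. *)
Lemma laplace_functional (g : R -> R) : measurable_fun setT g ->
  (forall x, 0 <= g x <= 1) ->
  \int[P]_w (\prod_(i < k) (1 - g (zeta i w))) @[k --> \oo] -->
  fine (expeR (- \int[lebesgue_measure]_(x in `]0%R, +oo[) (g x * x ^- 2)%:E)).
Proof.
move=> mg g01.
pose gn n x : R := floor_approx n (g x).
have gn01 n x : 0 <= gn n x <= 1.
  rewrite floor_approx_ge0; have /andP[g0 g1] := g01 x.
  by rewrite (le_trans (floor_approx_le _ _)).
have mgn n : measurable_fun setT (gn n) by exact: measurable_floor_approx.
have mpos (h : R -> R) : measurable_fun setT h ->
    measurable_fun (`]0, +oo[%classic : set R) (fun x => (h x * x ^- 2)%:E).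
  move=> mh; apply/measurable_EFinP; apply: measurable_funM; last exact: measurable_inv2.
  exact: measurable_funTS.
pose I (h : R -> R) := (\int[lebesgue_measure]_(x in `]0%R, +oo[) (h x * x ^- 2)%:E)%E : \bar R.
have I0 (h : R -> R) : (forall x, 0 <= h x <= 1) -> (0 <= I h)%E.
  move=> h01; apply: integral_ge0 => x _.
  by rewrite lee_fin mulr_ge0 ?invr_ge0 ?sqr_ge0//; case/andP: (h01 x).
pose b (h : R -> R) := fine (expeR (- I h)).
have expfin (h : R -> R) : (forall x, 0 <= h x <= 1) -> expeR (- I h) = (b h)%:E.
  move=> /I0; rewrite /b; case: (I h) => //.
have prod01 (h : R -> R) k w : (forall x, 0 <= h x <= 1) ->
    0 <= \prod_(i < k) (1 - h (zeta i w)) <= 1.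
  move=> h01; have h01' i : 0 <= 1 - h (zeta i w) <= 1.
    by have /andP[? ?] := h01 (zeta i w); apply/andP; split; lra.
  rewrite prodr_ge0/=; last by move=> i _; case/andP: (h01' i).
  exact: prodr_ile1.
have mprod (h : R -> R) k : measurable_fun setT h ->
    measurable_fun setT (fun w => \prod_(i < k) (1 - h (zeta i w))).
  move=> mh; apply: measurable_prod => i _; apply: measurable_funB => //.
  exact: measurableT_comp.
have iprod (h : R -> R) k : measurable_fun setT h -> (forall x, 0 <= h x <= 1) ->
    P.-integrable setT (EFin \o (fun w => \prod_(i < k) (1 - h (zeta i w)))).
  by move=> mh h01; apply: unit_integrable => [|w]; [exact: mprod|exact: prod01].
pose a h k := \int[P]_w (\prod_(i < k) (1 - h (zeta i w))).
have a_dec (h : R -> R) : measurable_fun setT h -> (forall x, 0 <= h x <= 1) ->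
    nonincreasing_seq (a h).
  move=> mh h01; apply/nonincreasing_seqP => k; apply: le_Rintegral => //; [exact: iprod..|].
  move=> w _; rewrite big_ord_recr/= ler_piMr//; first by case/andP: (prod01 h k w h01).
  by have /andP[? ?] := h01 (zeta k w); lra.
have a_ge0 (h : R -> R) k : (forall x, 0 <= h x <= 1) -> 0 <= a h k.
  by move=> h01; apply: Rintegral_ge0 => w _; case/andP: (prod01 h k w h01).
have a_cvg (h : R -> R) : measurable_fun setT h -> (forall x, 0 <= h x <= 1) -> cvgn (a h).
  move=> mh h01; apply: nonincreasing_is_cvgn; first exact: a_dec.
  by exists 0 => _ [k _ <-]; exact: a_ge0.
have an_cvg n : a (gn n) k @[k --> \oo] --> b (gn n) by exact: laplace_floor.
have Ign n : (I (gn n) <= I g)%E.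
  apply: ge0_le_integral => //.
  - by move=> x _; rewrite lee_fin mulr_ge0 ?invr_ge0 ?sqr_ge0//; case/andP: (gn01 n x).
  - exact: mpos.
  - exact: mpos.
  - move=> x _; rewrite lee_fin ler_wpM2r ?invr_ge0 ?sqr_ge0//.
    by apply: floor_approx_le; case/andP: (g01 x).
have b_le_a k : b g <= a g k.
  have ca : a (gn n) k @[n --> \oo] --> a g k.
    apply: (@bounded_cvg_Rintegral _ _ _ _ _ _ 1).
    - by move=> n; exact: mprod.
    - exact: mprod.
    - by move=> n w; have /andP[p0 p1] := prod01 (gn n) k w (gn01 n); rewrite ger0_norm.
    - apply: aeW => w; apply: cvg_big => //; first by move=> x; exact: mul_continuous.
      move=> i _; apply: cvgB; first exact: cvg_cst.
      by apply: cvg_floor_approx; case/andP: (g01 (zeta i w)).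
  rewrite -(cvg_lim _ ca)//; apply: limr_ge; first by apply/cvg_ex; exists (a g k).
  apply: nearW => n; apply: (@le_trans _ _ (b (gn n))).
    by rewrite -lee_fin -!expfin// lee_expeR leeN2.
  rewrite -(cvg_lim _ (@an_cvg n))//; apply: nonincreasing_cvgn_ge; first exact: a_dec.
  exact: a_cvg.
pose L := limn (a g).
have L_b n : L <= b (gn n).
  rewrite -(cvg_lim _ (@an_cvg n))//; apply: ler_lim; [exact: a_cvg..|].
  apply: nearW => k; apply: le_Rintegral => //; [exact: iprod..|].
  move=> w _; apply: ler_prod => i _; have /andP[g0 g1] := g01 (zeta i w).
  by rewrite subr_ge0 g1 lerB// floor_approx_le.
suff Lb : L = b g by rewrite -/(b g) -Lb; exact: a_cvg.
apply/eqP; rewrite eq_le; apply/andP; split; last first.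
  by apply: limr_ge; [exact: a_cvg|exact: nearW].
(* A positive [L] is [expR l], and [L <= b (gn n)] becomes the bound [- l] on the integrals
   [I (gn n)], the form in which Fatou's lemma applies. *)
have [L0|L0] := leP L 0.
  by rewrite (le_trans L0)// fine_ge0// expeR_ge0.
have [l lL] := expR_total L0.
have Il n : (I (gn n) <= (- l)%:E)%E.
  have := L_b n; rewrite -lee_fin -expfin// -lL -[X in (X <= _)%E]/(expeR l%:E).
  by rewrite lee_expeR leeNr EFinN.
rewrite -lee_fin -expfin// -lL -[X in (X <= _)%E]/(expeR l%:E) lee_expeR leeNr -EFinN.
have := @fatou _ _ _ lebesgue_measure _ mD (fun n x => (gn n x * x ^- 2)%:E).
move=> /(_ (fun n => mpos _ (mgn n))).
have h0 n x : (`]0, +oo[%classic : set R) x -> (0 <= (gn n x * x ^- 2)%:E)%E.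
  by move=> _; rewrite lee_fin mulr_ge0 ?invr_ge0 ?sqr_ge0//; case/andP: (gn01 n x).
move=> /(_ h0) fat.
have -> : I g = (\int[lebesgue_measure]_(x in `]0%R, +oo[)
    limn_einf (fun n => (gn n x * x ^- 2)%:E))%E.
  apply: eq_integral => x _.
  have cx : (gn n x * x ^- 2)%:E @[n --> \oo] --> (g x * x ^- 2)%:E.
    apply: cvg_EFin; first exact: nearW.
    apply: cvgM; last exact: cvg_cst.
    by apply: cvg_floor_approx; case/andP: (g01 x).
  rewrite is_cvg_limn_einfE; first by rewrite (cvg_lim _ cx).
  by apply/cvg_ex; exists (g x * x ^- 2)%:E.
apply: (le_trans fat); rewrite limn_einf_lim; apply: lime_le.
  exact: is_cvg_einfs.
apply: nearW => n; apply: (le_trans _ (Il n)); rewrite /einfs.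
by apply: ereal_inf_lbound; exists n => //=.
Qed.

End laplace_functional.

(** * Marking: the avoidance formula *)

Section decoupling.
Context {R : realType} d {T : measurableType d} (P : probability T R).

(** The joint law of [U] and [V] agrees with the product of their laws on rectangles, hence
    everywhere; Tonelli's theorem applies to the product, and both integrals are pulled back to
    [T]. *)
Lemma independent_Fubini d1 d2 (E1 : measurableType d1) (E2 : measurableType d2)
    (U : T -> E1) (V : T -> E2) (F : E1 * E2 -> \bar R) :
  measurable_fun setT U -> measurable_fun setT V ->
  (forall A B, measurable A -> measurable B ->
    P (U @^-1` A `&` V @^-1` B) = P (U @^-1` A) * P (V @^-1` B))%E ->
  measurable_fun setT F -> (forall x, 0 <= F x)%E ->
  (\int[P]_w F (U w, V w) = \int[P]_w \int[P]_w' F (U w, V w'))%E.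
Proof.
move=> mU mV indUV mF F0.
pose U' : {mfun T >-> E1} := HB.pack U (isMeasurableFun.Build _ _ _ _ U mU).
pose V' : {mfun T >-> E2} := HB.pack V (isMeasurableFun.Build _ _ _ _ V mV).
pose W w := (U w, V w).
have mW : measurable_fun setT W by exact: measurable_fun_pair.
pose W' : {mfun T >-> (E1 * E2)%type} :=
  HB.pack W (isMeasurableFun.Build _ _ _ _ W mW).
have WE X : measurable X ->
    (distribution P U' \x distribution P V')%E X = distribution P W' X.
  by apply: product_measure_unique => A B mA mB; exact: indUV.
transitivity (\int[distribution P W']_z F z)%E.
  by rewrite (@ge0_integral_distribution _ _ _ _ _ _ W').
transitivity (\int[distribution P U' \x distribution P V']_z F z)%E.
  by apply: eq_measure_integral => A mA _; exact/esym/WE.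
rewrite (fubini_tonelli1 _ mF F0).
rewrite (@ge0_integral_distribution _ _ _ _ _ _ U'); last 2 first.
- exact: measurable_fun_fubini_tonelli_F.
- by move=> x; exact: integral_ge0.
apply: eq_integral => w _ /=; rewrite /fubini_F.
rewrite (@ge0_integral_distribution _ _ _ _ _ _ V')//.
exact: measurable_fun_pair2.
Qed.

(** With the generated sigma-algebra carried by the type, membership of an event in [sigma_family]
    reduces to measurability of a map. *)
Lemma measurable_sigma_family d' (E : measurableType d') (I : Type) (D : set I)
    (Z : I -> T -> E) i : D i ->
  measurable_fun setT (Z i : g_sigma_algebraType
    (\bigcup_(i in D) preimage_set_system setT (Z i) measurable) -> E).
Proof.
move=> Di _ B mB; apply: sub_sigma_algebra; exists i => //.
by exists B.
Qed.

Lemma sub_sigma_family d' (E : measurableType d') (I : Type) (D : set I)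
    (Z : I -> T -> E) A : measurable_family D Z -> sigma_family D Z A -> measurable A.
Proof.
move=> mZ; apply: smallest_sub; first exact: sigma_algebra_measurable.
by move=> _ [i Di [B mB <-]]; exact: mZ.
Qed.

End decoupling.

Section pair_law.
Context {R : realType} d1 d2 {T1 : measurableType d1} {T2 : measurableType d2}.
Context (P1 : probability T1 R) (P2 : probability T2 R) (I : Type) (D : set I).

(** [same_law] gives equality on rectangles only; these are stable under intersection and generate
    the Borel sets of the plane. *)
Lemma same_law_pair (Z1 : I -> T1 -> R) (Z2 : I -> T2 -> R) i j (A : set (R * R)) :
  measurable_family D Z1 -> measurable_family D Z2 -> D i -> D j ->
  same_law P1 P2 D Z1 Z2 -> measurable A ->
  P1 [set w | A (Z1 i w, Z1 j w)] = P2 [set w | A (Z2 i w, Z2 j w)].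
Proof.
move=> mZ1 mZ2 Di Dj Z12 mA.
have m1 : measurable_fun setT (fun w => (Z1 i w, Z1 j w)).
  by apply: measurable_fun_pair; exact: mZ1.
have m2 : measurable_fun setT (fun w => (Z2 i w, Z2 j w)).
  by apply: measurable_fun_pair; exact: mZ2.
pose W1 w := (Z1 i w, Z1 j w).
pose X1 : {mfun T1 >-> (R * R)%type} := HB.pack W1 (isMeasurableFun.Build _ _ _ _ W1 m1).
pose W2 w := (Z2 i w, Z2 j w).
pose X2 : {mfun T2 >-> (R * R)%type} := HB.pack W2 (isMeasurableFun.Build _ _ _ _ W2 m2).
change (distribution P1 X1 A = distribution P2 X2 A).
apply: (measure_unique [set B `*` C | B in measurable & C in measurable]
  (fun=> setT)) => //.
- exact: measurable_prod_measurableType.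
- move=> _ _ [B mB [C mC <-]] [B' mB' [C' mC' <-]]; rewrite -setXI.
  exists (B `&` B'); first exact: measurableI.
  by exists (C `&` C'); first exact: measurableI.
- by move=> _; exists setT => //; exists setT => //; rewrite setXTT.
- by rewrite bigcup_const.
- move=> _ [B mB [C mC <-]].
  have E1 : distribution P1 X1 (B `*` C) = P1 [set w | forall k : 'I_2,
    (if k == ord0 then B else C) (Z1 (if k == ord0 then i else j) w)].
    congr (P1 _); apply/seteqP; split => w /=.
      by move=> [? ?] k; case: ifP.
    by move=> h; split; [exact: (h ord0)|exact: (h ord_max)].
  have E2 : distribution P2 X2 (B `*` C) = P2 [set w | forall k : 'I_2,
    (if k == ord0 then B else C) (Z2 (if k == ord0 then i else j) w)].
    congr (P2 _); apply/seteqP; split => w /=.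
      by move=> [? ?] k; case: ifP.
    by move=> h; split; [exact: (h ord0)|exact: (h ord_max)].
  apply: (etrans E1); apply: (etrans _ (esym E2)).
  apply: (Z12 2 (fun k : 'I_2 => if k == ord0 then i else j)
    (fun k : 'I_2 => if k == ord0 then B else C)) => k; by case: ifP.
- move=> _; apply: (@le_lt_trans _ _ 1%E); last exact: ltry.
  exact: (@probability_le1 _ _ _ (distribution P1 X1)).
Qed.

Lemma same_law_integral_pair (Z1 : I -> T1 -> R) (Z2 : I -> T2 -> R) i j
    (f : R * R -> R) :
  measurable_family D Z1 -> measurable_family D Z2 -> D i -> D j ->
  same_law P1 P2 D Z1 Z2 -> measurable_fun setT f -> (forall x, 0 <= f x) ->
  \int[P1]_w f (Z1 i w, Z1 j w) = \int[P2]_w f (Z2 i w, Z2 j w).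
Proof.
move=> mZ1 mZ2 Di Dj Z12 mf f0.
have m1 : measurable_fun setT (fun w => (Z1 i w, Z1 j w)).
  by apply: measurable_fun_pair; exact: mZ1.
have m2 : measurable_fun setT (fun w => (Z2 i w, Z2 j w)).
  by apply: measurable_fun_pair; exact: mZ2.
pose W1 w := (Z1 i w, Z1 j w).
pose X1 : {mfun T1 >-> (R * R)%type} := HB.pack W1 (isMeasurableFun.Build _ _ _ _ W1 m1).
pose W2 w := (Z2 i w, Z2 j w).
pose X2 : {mfun T2 >-> (R * R)%type} := HB.pack W2 (isMeasurableFun.Build _ _ _ _ W2 m2).
have mEf : measurable_fun setT (EFin \o f) by exact/measurable_EFinP.
have Ef0 x : (0 <= (EFin \o f) x)%E by rewrite lee_fin.
rewrite /Rintegral; congr fine.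
transitivity (\int[distribution P1 X1]_y (EFin \o f) y)%E.
  by rewrite (@ge0_integral_distribution _ _ _ _ _ _ X1).
transitivity (\int[distribution P2 X2]_y (EFin \o f) y)%E.
  by apply: eq_measure_integral => A mA _; exact: (same_law_pair mZ1 mZ2 Di Dj Z12).
by rewrite (@ge0_integral_distribution _ _ _ _ _ _ X2).
Qed.

End pair_law.

(** * Tail and scaling of integrals against the intensity *)

Section inverse_square_integral.
Context {R : realType}.

Lemma integral_inv2_ge (a : R) : 0 < a ->
  (\int[lebesgue_measure]_(x in `[a, +oo[) (x ^- 2)%:E = (a^-1)%:E)%E.
Proof.
move=> a0.
have dV (x : R) : 0 < x -> is_derive x 1 (fun y : R => - y^-1) (x ^- 2).
  move=> x0.
  have -> : x ^- 2 = - (- x ^- 2 *: (1 : R)) by rewrite scaleNr opprK /GRing.scale/= mulr1.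
  by apply: is_deriveN; apply: is_deriveV; rewrite ?gt_eqF.
rewrite (@ge0_continuous_FTC2y _ _ (fun x => - x^-1) a 0).
- by rewrite -EFinB sub0r opprK.
- by move=> x _; rewrite invr_ge0 sqr_ge0.
- apply: continuous_in_subspaceT => x; rewrite inE/= in_itv/= andbT => ax.
  by apply: continuous_inv2; exact: lt_le_trans ax.
- rewrite -oppr0; apply: cvgN; apply/gtr0_cvgV0; [exact: nbhs_pinfty_gt|exact: cvg_id].
- by move=> x ax; have [] := dV x (lt_trans a0 ax).
- apply: cvg_at_right_filter; apply: cvgN; apply: cvgV; first by rewrite gt_eqF.
  exact: cvg_id.
- move=> x; rewrite in_itv/= andbT => ax; rewrite derive1E.
  by have [_ ->] := dV x (lt_trans a0 ax).
Qed.

Definition double (x : measurableTypeR R) : measurableTypeR R := 2 * x.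

Lemma measurable_double : measurable_fun setT double.
Proof. by apply: measurable_funM. Qed.

(** Twice the image of Lebesgue measure under doubling, which is Lebesgue measure again: the
    substitution [y = 2x] as an identity of measures. *)
Definition double_image : {measure set (measurableTypeR R) -> \bar R} :=
  mscale (2%:R%:nng) (measure_function_pushforward__canonical__measure_function_Measure
    (@lebesgue_measure R) measurable_double).

Lemma lebesgue_measure_double (A : set R) : measurable A ->
  lebesgue_measure A = double_image A.
Proof.
move=> mA; apply: lebesgue_measure_unique => //= _ [[a b]] _ <-.
rewrite /mscale/= /pushforward.
rewrite (_ : double @^-1` _ = `]a / 2, b / 2]%classic); last first.
  apply/seteqP; split => x /=; rewrite !in_itv/= /double ltr_pdivrMr// ler_pdivlMr//;
  by rewrite [2 * x]mulrC.
rewrite !lebesgue_measure_itv/= !lte_fin ltr_pM2r ?invr_gt0//.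
case: ifPn => _; last by rewrite mule0.
by rewrite -!EFinB -EFinM; congr EFin; field.
Qed.

(** In the substitution [y = 2x] the intensity contributes a factor 4 and the length element a
    factor 1/2. *)
Lemma integral_inv2_double (g : R -> R) : measurable_fun setT g ->
  (forall x, 0 <= g x) ->
  (\int[lebesgue_measure]_(x in `]0%R, +oo[) (g (2 * x)%R * x ^- 2)%:E =
   2%:E * \int[lebesgue_measure]_(x in `]0%R, +oo[) (g x * x ^- 2)%:E)%E.
Proof.
move=> mg g0; pose h (y : R) := (g y * y ^- 2)%:E.
have mD : measurable (`]0, +oo[%classic : set R) by exact: measurable_itv.
have mh' : measurable_fun (`]0, +oo[%classic : set R) (fun x => h (2 * x)).
  apply/measurable_EFinP; apply: measurable_funM.
    apply: measurable_funTS; apply: (measurableT_comp mg); exact: measurable_double.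
  apply: (@measurable_comp _ _ _ _ _ _ (`]0, +oo[%classic : set R)
    (fun y : R => y ^- 2) _ double) => //.
  - by move=> _ [x /= x0 <-]; move: x0; rewrite !in_itv/= !andbT => ?; rewrite mulr_gt0.
  - exact: measurable_inv2.
  - by apply: measurable_funTS; exact: measurable_double.
have mh : measurable_fun (`]0, +oo[%classic : set R) h.
  apply/measurable_EFinP; apply: measurable_funM; last exact: measurable_inv2.
  exact: measurable_funTS.
have h0 x : (`]0, +oo[%classic : set R) x -> (0 <= h x)%E.
  by move=> _; rewrite lee_fin mulr_ge0// invr_ge0 sqr_ge0.
have -> : (\int[lebesgue_measure]_(x in `]0%R, +oo[) (g x * x ^- 2)%:E =
    2%:E * \int[lebesgue_measure]_(x in `]0%R, +oo[) h (2 * x)%R)%E.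
  transitivity (\int[double_image]_(x in `]0%R, +oo[) h x)%E.
    by apply: eq_measure_integral => A mA _; exact: lebesgue_measure_double.
  rewrite /double_image ge0_integral_mscale//; congr (_ * _)%E.
  rewrite (ge0_integral_pushforward measurable_double)//;
    last by move=> x; rewrite inE => /h0.
  congr (integral _ _ _); apply/seteqP; split => x /=;
  by rewrite !in_itv/= /double pmulr_rgt0.
rewrite muleA -EFinM -ge0_integralZl//; last first.
  by move=> x x0; apply: h0; move: x0; rewrite /= !in_itv/= !andbT => ?; rewrite mulr_gt0.
apply: eq_integral => x; rewrite inE/= in_itv/= andbT => x0.
rewrite /h -EFinM; congr EFin; field.
by rewrite gt_eqF.
Qed.

End inverse_square_integral.

(** * The planar process of marked points and its intensity *)

Section marked_points.
Context {R : realType} d {T : measurableType d} (P : probability T R).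
Context (k : nat) (X : set 'rV[R]_k).
Context d' {T' : measurableType d'} (Q : probability T' R).
Variables (Y : 'rV[R]_k -> T' -> R) (zeta : nat -> T -> R)
  (Yi : nat -> 'rV[R]_k -> T -> R) (s1 s2 : 'rV[R]_k).
Hypotheses (Xs1 : X s1) (Xs2 : X s2).
Hypothesis mY : measurable_family X Y.
Hypothesis hzeta : poisson_points P `]0, +oo[%classic (fun x => x ^- 2) zeta.
Hypothesis hYi : independent_copies P X Q Y Yi.
Hypothesis hind : independent2 P (sigma_family setT zeta)
  (sigma_family [set p : nat * 'rV[R]_k | X p.2] (fun p => Yi p.1 p.2)).

Definition scale_point (z : R) (x : R * R) : R * R := (z * x.1, z * x.2).

Definition spectral_pair (i : nat) (w : T) : R * R :=
  (spectral_functions zeta Yi i s1 w, spectral_functions zeta Yi i s2 w).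

Definition mark_pair (w : T') : R * R := (Y s1 w, Y s2 w).

Lemma measurable_scale_point d0 (U : measurableType d0) (z : U -> R) (x : U -> R * R) :
  measurable_fun setT z -> measurable_fun setT x ->
  measurable_fun setT (fun u => scale_point (z u) (x u)).
Proof.
move=> mz mx; apply: measurable_fun_pair; apply: measurable_funM => //.
  exact: (measurableT_comp measurable_fst mx).
exact: (measurableT_comp measurable_snd mx).
Qed.

Let mzeta i : measurable_fun setT (zeta i).
Proof. by have [mz _ _ _] := hzeta; exact: mz. Qed.

Let mYi i : measurable_family X (Yi i).
Proof. by have [/(_ i)[]] := hYi. Qed.

Lemma measurable_mark_pair : measurable_fun setT mark_pair.
Proof. by apply: measurable_fun_pair; exact: mY. Qed.

Lemma measurable_spectral_pair i : measurable_fun setT (spectral_pair i).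
Proof.
by apply: measurable_fun_pair; apply: measurable_funM; [|exact: mYi| |exact: mYi].
Qed.

Lemma measurable_thinning (f : R * R -> R) : measurable_fun setT f ->
  (forall x, 0 <= f x <= 1) ->
  measurable_fun setT (fun x : R => \int[Q]_w (1 - f (scale_point x (mark_pair w)))).
Proof.
move=> mf f01; apply: measurableT_comp; first exact: fine_measurable.
apply: (@measurable_fun_fubini_tonelli_F _ _ _ _ _ Q
  (fun z : R * T' => (1 - f (scale_point z.1 (mark_pair z.2)))%:E)).
  apply/measurable_EFinP; apply: measurable_funB => //.
  apply: (measurableT_comp mf); apply: measurable_scale_point => //.
  by apply: (measurableT_comp measurable_mark_pair); exact: measurable_snd.
by move=> z; rewrite lee_fin subr_ge0; case/andP: (f01 (scale_point z.1 (mark_pair z.2))).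
Qed.

Lemma thinning01 (f : R * R -> R) x : measurable_fun setT f ->
  (forall x, 0 <= f x <= 1) ->
  0 <= \int[Q]_w (1 - f (scale_point x (mark_pair w))) <= 1.
Proof.
move=> mf f01.
have h01 w : 0 <= 1 - f (scale_point x (mark_pair w)) <= 1.
  by have /andP[? ?] := f01 (scale_point x (mark_pair w)); apply/andP; split; lra.
rewrite Rintegral_ge0/=; last by move=> w _; case/andP: (h01 w).
apply: (@le_trans _ _ (\int[Q]_w 1)).
  apply: le_Rintegral => //.
  - apply: unit_integrable => //; apply: measurable_funB => //.
    apply: (measurableT_comp mf); apply: measurable_scale_point => //.
    exact: measurable_mark_pair.
  - by apply: unit_integrable => // _; rewrite ler01 lexx.
  - by move=> w _; case/andP: (h01 w).
by rewrite Rintegral_cst// mul1r -lee_fin fineK ?probability_le1// fin_num_measure.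
Qed.

(* The points are independent of the marks: integrate the marks out first. *)
Lemma integral_prod_spectral (f : R * R -> R) n : measurable_fun setT f ->
  (forall x, 0 <= f x <= 1) ->
  \int[P]_w (\prod_(i < n) f (spectral_pair i w)) =
  \int[P]_w (\prod_(i < n)
    (1 - \int[Q]_w' (1 - f (scale_point (zeta i w) (mark_pair w'))))).
Proof.
move=> mf f01.
pose D := [set p : nat * 'rV[R]_k | X p.2].
pose Z (p : nat * 'rV[R]_k) := Yi p.1 p.2.
(* [Tz] and [Ty] are the sample space with the events of the points alone and of the marks alone.
   The two identity maps out of [T] are independent by [hind], so the integrand at [(w, w)] can be
   decoupled. *)
pose Tz := g_sigma_algebraType
  (\bigcup_(i in setT) preimage_set_system setT (zeta i) measurable).
pose Ty := g_sigma_algebraType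
  (\bigcup_(p in D) preimage_set_system setT (Z p) measurable).
have mz (i : nat) : measurable_fun setT (zeta i : Tz -> R).
  exact: (@measurable_sigma_family d T).
have my i s : X s -> measurable_fun setT (Yi i s : Ty -> R).
  by move=> Xs; exact: (@measurable_sigma_family d T _ _ _ D Z (i, s)).
have mfY : measurable_family D Z by move=> [i s]/= Xs; exact: mYi.
have mfz : measurable_family setT zeta by move=> i _.
have mU : measurable_fun setT (id : T -> Tz).
  by move=> _ B mB; rewrite setTI; exact: (sub_sigma_family mfz).
have mV : measurable_fun setT (id : T -> Ty).
  by move=> _ B mB; rewrite setTI; exact: (sub_sigma_family mfY).
pose pairY i w := (Yi i s1 w, Yi i s2 w).
have mpairY i : measurable_fun setT (pairY i : Ty -> R * R).
  by apply: measurable_fun_pair; exact: my.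
pose F (z : Tz * Ty) : \bar R :=
  (\prod_(i < n) f (scale_point (zeta i z.1) (pairY i z.2)))%:E.
have F0 z : (0 <= F z)%E.
  by rewrite lee_fin; apply: prodr_ge0 => i _;
    case/andP: (f01 (scale_point (zeta i z.1) (pairY i z.2))).
have mF : measurable_fun setT F.
  apply/measurable_EFinP; apply: measurable_prod => i _.
  apply: (measurableT_comp mf); apply: measurable_scale_point.
    by apply: (measurableT_comp (mz i)); exact: measurable_fst.
  by apply: (measurableT_comp (mpairY i)); exact: measurable_snd.
rewrite /Rintegral; congr fine.
rewrite -[LHS]/(\int[P]_w F (w, w))%E (independent_Fubini mU mV)//.
apply: eq_integral => w _; rewrite /F.
have [_ lawY indY] := hYi.
have mpairT i : measurable_fun setT (pairY i).
  by apply: measurable_fun_pair; exact: mYi.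
have msc x : measurable_fun setT (fun y => f (scale_point x y)).
  by apply: (measurableT_comp mf); exact: measurable_scale_point.
have := @Rintegral_prod_independent _ _ _ P _ _ n (fun i => pairY i)
  (fun (i : 'I_n) y => f (scale_point (zeta i w) y)).
move=> /(_ (fun i => mpairT i)) h.
have {h} := h _ (fun i => msc (zeta i w)) (fun i x => f01 _).
move=> h; rewrite -[LHS]fineK; last first.
  apply: integrable_fin_num => //; apply: unit_integrable => [|w'].
    apply: measurable_prod => i _; exact: (measurableT_comp (msc (zeta i w)) (mpairT i)).
  rewrite prodr_ge0/=; last by move=> i _; case/andP: (f01 (scale_point (zeta i w) (pairY i w'))).
  by apply: prodr_ile1 => i _; exact: f01.
congr EFin; rewrite [LHS]h; last first.
  move=> B mB; apply: (mutually_independent_ord (e := fun i : 'I_n => val i) val_inj indY) => j.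
  rewrite -[X in sigma_family _ _ X]setTI.
  have : measurable_fun setT (pairY j : g_sigma_algebraType
    (\bigcup_(s in X) preimage_set_system setT (Yi j s) measurable) -> R * R).
    by apply: measurable_fun_pair; exact: (@measurable_sigma_family d T _ _ _ X (Yi j)).
  by apply.
apply: eq_bigr => i _.
rewrite (@same_law_integral_pair _ _ _ _ _ P Q _ X (Yi i) Y s1 s2
  (fun y => f (scale_point (zeta i w) y)))//; last first.
  by move=> y; case/andP: (f01 (scale_point (zeta i w) y)).
rewrite -[in RHS]/(\int[Q]_w' (1 - f (scale_point (zeta i w) (mark_pair w')))).
have iQ : Q.-integrable setT (EFin \o (fun w' => f (scale_point (zeta i w) (mark_pair w')))).
  apply: unit_integrable => [|w']; last exact: f01.
  exact: (measurableT_comp (msc (zeta i w)) measurable_mark_pair).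
rewrite RintegralB//; last by apply: unit_integrable => // _; rewrite ler01 lexx.
rewrite Rintegral_cst// mul1r (_ : fine _ = 1); first by rewrite subKr.
by rewrite -[RHS]/(fine 1%E); congr fine; exact: probability_setT.
Qed.

(** The marking theorem in Laplace form: integrating out the marks leaves a product over the points
    alone, whose [g x] is the mean of [1 - f] at a mark scaled by [x]. *)
Lemma marked_laplace (f : R * R -> R) : measurable_fun setT f ->
  (forall x, 0 <= f x <= 1) ->
  \int[P]_w (\prod_(i < n) f (spectral_pair i w)) @[n --> \oo] -->
  fine (expeR (- \int[lebesgue_measure]_(x in `]0%R, +oo[)
     ((\int[Q]_w (1 - f (scale_point x (mark_pair w)))) * x ^- 2)%:E)).
Proof.
move=> mf f01; under eq_fun do rewrite integral_prod_spectral//.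
apply: (laplace_functional hzeta); first exact: measurable_thinning.
by move=> x; exact: thinning01.
Qed.


Definition cover_prob (A : set (R * R)) (x : R) : R :=
  \int[Q]_w \1_A (scale_point x (mark_pair w)).

(** The intensity [mu] of the planar process, known as the exponent measure of the max-stable pair.
    A plain function on sets is enough, since only additivity on two disjoint sets, scaling and the
    values on half-planes enter. *)
Definition exponent_measure (A : set (R * R)) : \bar R :=
  (\int[lebesgue_measure]_(x in `]0%R, +oo[) (cover_prob A x * x ^- 2)%:E)%E.

Let complement_indic (A : set (R * R)) (c : R) : measurable A -> 0 <= c <= 1 ->
  measurable_fun setT (fun x => 1 - c * \1_A x : R) /\
  (forall x, 0 <= 1 - c * \1_A x <= 1).
Proof.
move=> mA /andP[c0 c1]; split.
  by apply: measurable_funB => //; apply: measurable_funM => //; exact: measurable_indic.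
by move=> x; rewrite indicE; case: (_ \in _); rewrite ?mulr1 ?mulr0; apply/andP; split; lra.
Qed.

Lemma measurable_cover_prob A : measurable A -> measurable_fun setT (cover_prob A).
Proof.
move=> mA; have [|m1 h1] := @complement_indic A 1 mA; first by rewrite ler01 lexx.
have := measurable_thinning m1 h1; congr (measurable_fun _ _).
apply/funext => x; apply: eq_Rintegral => w _; ring.
Qed.

Lemma cover_prob01 A x : measurable A -> 0 <= cover_prob A x <= 1.
Proof.
move=> mA; have [|m1 h1] := @complement_indic A 1 mA; first by rewrite ler01 lexx.
have := thinning01 x m1 h1; rewrite (_ : \int[Q]_w _ = cover_prob A x)//.
by apply: eq_Rintegral => w _; ring.
Qed.

Lemma exponent_measure_ge0 A : measurable A -> (0 <= exponent_measure A)%E.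
Proof.
move=> mA; apply: integral_ge0 => x _.
by rewrite lee_fin mulr_ge0 ?invr_ge0 ?sqr_ge0//; case/andP: (cover_prob01 x mA).
Qed.

Let measurable_exponent A : measurable A ->
  measurable_fun (`]0, +oo[%classic : set R) (fun x => (cover_prob A x * x ^- 2)%:E).
Proof.
move=> mA; apply/measurable_EFinP; apply: measurable_funM; last exact: measurable_inv2.
by apply: measurable_funTS; exact: measurable_cover_prob.
Qed.

Let exponent_term_ge0 A x : measurable A -> (0 <= (cover_prob A x * x ^- 2)%:E)%E.
Proof.
move=> mA; rewrite lee_fin mulr_ge0 ?invr_ge0 ?sqr_ge0//.
by case/andP: (cover_prob01 x mA).
Qed.

(** The value [c = 1] yields the avoidance probability; small [c] shows that a set of finite
    intensity is hit finitely often. *)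
Lemma thinned_laplace (A : set (R * R)) (c : R) : measurable A -> 0 <= c <= 1 ->
  \int[P]_w (\prod_(i < n) (1 - c * \1_A (spectral_pair i w))) @[n --> \oo] -->
  fine (expeR (- (c%:E * exponent_measure A))).
Proof.
move=> mA c01; have [m1 h1] := complement_indic mA c01.
have := marked_laplace m1 h1.
rewrite /exponent_measure -ge0_integralZl//; last 3 first.
- exact: measurable_exponent.
- by move=> x _; exact: exponent_term_ge0.
- by case/andP: c01.
congr (_ --> fine (expeR (- _))); apply: eq_integral => x _.
rewrite -EFinM mulrA; congr (_ * _)%:E.
rewrite /cover_prob -RintegralZl//.
  by apply: eq_Rintegral => w _; ring.
apply: unit_integrable => [|w]; last by rewrite indicE; case: (_ \in _); rewrite ler01 lexx.
apply: (@measurableT_comp _ _ _ _ _ _ (\1_A : R * R -> R)); first exact: measurable_indic.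
by apply: measurable_scale_point => //; exact: measurable_mark_pair.
Qed.

(** With [c = 1] the partial products are 0 as soon as some point falls in [A] and stay 1 otherwise,
    so they converge to the indicator of avoidance. *)
Lemma avoidance A : measurable A ->
  P [set w | forall i, ~ A (spectral_pair i w)] = expeR (- exponent_measure A).
Proof.
move=> mA.
have mpre i : measurable (spectral_pair i @^-1` A).
  by rewrite -[X in measurable X]setTI; exact: measurable_spectral_pair.
have mB : measurable [set w | forall i, ~ A (spectral_pair i w)].
  rewrite (_ : mkset _ = \bigcap_i ~` (spectral_pair i @^-1` A)).
    by apply: bigcapT_measurable => i; exact: measurableC.
  by apply/seteqP; split => w /= h i; [move=> _; exact: h|exact: (h i)].
have [|m1 h1] := @complement_indic A 1 mA; first by rewrite ler01 lexx.
have c1 : \int[P]_w (\prod_(i < n) (1 - 1 * \1_A (spectral_pair i w))) @[n --> \oo] -->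
    \int[P]_w \1_[set w | forall i, ~ A (spectral_pair i w)] w.
  apply: (@bounded_cvg_Rintegral _ _ _ _ _ _ 1).
  - move=> n; apply: measurable_prod => i _.
    exact: (measurableT_comp m1 (measurable_spectral_pair i)).
  - exact: measurable_indic.
  - move=> n w; rewrite ger0_norm.
      by apply: prodr_ile1 => i _; exact: h1.
    by apply: prodr_ge0 => i _; case/andP: (h1 (spectral_pair i w)).
  - apply: aeW => w; rewrite indicE.
    have [h|/existsNP[i /contrapT Ai]] := pselect (forall i, ~ A (spectral_pair i w)).
      rewrite mem_set//; apply: cvg_near_cst; apply: nearW => n.
      by rewrite big1// => i _; rewrite indicE memNset ?mulr0 ?subr0//; exact: h.
    rewrite memNset; last by move=> /(_ i).
    apply: cvg_near_cst; exists i.+1 => // n /= lt_in.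
    by rewrite (bigD1 (Ordinal lt_in))//= indicE mem_set// mulr1 subrr mul0r.
have := thinned_laplace mA (c := 1); rewrite ler01 lexx => /(_ isT) c2.
have := cvg_unique _ c1 c2; rewrite Rintegral_indic// mul1e => E.
have e0 := exponent_measure_ge0 mA.
have <- : (fine (expeR (- exponent_measure A)))%:E = expeR (- exponent_measure A).
  by rewrite fineK//; move: e0; case: (exponent_measure A).
by rewrite -E// fineK ?fin_num_measure.
Qed.

(** With [N] the number of hits and [l] the intensity of [A], the mean of [(1 - e) ^ N] is
    [expR (- (e * l))], at least [1 - e * l]. The power vanishes where [N] is infinite, so [N] is
    finite with probability at least [1 - e * l] for every [e] in []0, 1]]. *)
Lemma finitely_many_hits A : measurable A -> (exponent_measure A < +oo)%E ->
  {ae P, forall w, finite_set [set i | A (spectral_pair i w)]}.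
Proof.
move=> mA Aoo.
have mpre i : measurable (spectral_pair i @^-1` A).
  by rewrite -[X in measurable X]setTI; exact: measurable_spectral_pair.
have e_fin : exponent_measure A \is a fin_num.
  by rewrite ge0_fin_numE// exponent_measure_ge0.
pose l := fine (exponent_measure A).
have l0 : 0 <= l by rewrite fine_ge0// exponent_measure_ge0.
pose N w : \bar R := counting [set i | A (spectral_pair i w)].
have mN : measurable_fun setT N.
  apply: (@emeasurable_fun_cvg _ _ _ _
    (fun n w => (hits (spectral_pair ^~ w) A n)%:R%:E)) => [n|w _]; last exact: cvg_hits.
  apply/measurable_EFinP.
  rewrite (_ : (fun w => _) = fun w => \sum_(i < n) \1_A (spectral_pair i w)); last first.
    by apply/funext => w; rewrite /hits natr_sum.
  apply: measurable_sum => i.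
  apply: (@measurableT_comp _ _ _ _ _ _ (\1_A : R * R -> R)); first exact: measurable_indic.
  exact: measurable_spectral_pair.
pose B := [set w | N w = +oo%E].
have mB : measurable B.
  rewrite -[X in measurable X]setTI.
  by apply: (mN measurableT [set +oo%E]); exact: emeasurable_set1.
have PB (e : R) : 0 < e <= 1 -> 1 - e * l <= fine (P (~` B)).
  move=> /andP[e0 e1]; have ce0 : 0 <= 1 - e < 1 by apply/andP; split; lra.
  have [|m1 h1] := @complement_indic A e mA; first by rewrite e1 ltW.
  have := thinned_laplace mA (c := e); rewrite e1 ltW// => /(_ isT).
  rewrite -(fineK e_fin) -EFinM/= => c2.
  apply: (@le_trans _ _ (expR (- (e * l)))).
    by have := expR_ge1Dx (- (e * l)); rewrite -/l.
  rewrite -(cvg_lim _ c2)//.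
  have pc0 w := pow_count_ge0 (N w) (proj1 (andP ce0)).
  have pc1 w : (pow_count (1 - e) (N w) <= 1)%E.
    by apply: pow_count_le1; case/andP: ce0 => -> /ltW ->.
  have pcK w : (fine (pow_count (1 - e) (N w)))%:E = pow_count (1 - e) (N w).
    by rewrite fineK// ge0_fin_numE// (le_lt_trans (pc1 w))// ltry.
  have prodE n w : \prod_(i < n) (1 - e * \1_A (spectral_pair i w)) =
      (1 - e) ^+ hits (spectral_pair ^~ w) A n.
    rewrite /hits expr_sum; apply: eq_bigr => i _; rewrite indicE.
    by case: (_ \in _); rewrite ?mulr1 ?mulr0 ?subr0.
  have mpc : measurable_fun setT (fun w => fine (pow_count (1 - e) (N w))).
    apply: measurableT_comp; first exact: fine_measurable.
    by apply: (measurableT_comp _ mN); apply: measurable_pow_count; case/andP: ce0.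
  have c1 : \int[P]_w (\prod_(i < n) (1 - e * \1_A (spectral_pair i w))) @[n --> \oo] -->
      \int[P]_w (fine (pow_count (1 - e) (N w))).
    apply: (@bounded_cvg_Rintegral _ _ _ _ _ _ 1) => //.
    - move=> n; apply: measurable_prod => i _.
      exact: (measurableT_comp m1 (measurable_spectral_pair i)).
    - move=> n w; rewrite ger0_norm.
        by apply: prodr_ile1 => i _; exact: h1.
      by apply: prodr_ge0 => i _; case/andP: (h1 (spectral_pair i w)).
    - apply: aeW => w; under eq_fun do rewrite prodE.
      by have := @cvg_pow_hits _ _ _ (spectral_pair ^~ w) A ce0; rewrite -/(N w) -pcK => /fine_cvg.
  rewrite (cvg_lim _ c1)// -Rintegral_indic; last exact: measurableC.
  apply: le_Rintegral => //.
  - by apply: unit_integrable => // w; rewrite -!lee_fin pcK pc0 pc1.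
  - apply: unit_integrable => [|w]; first by apply: measurable_indic; exact: measurableC.
    by rewrite indicE; case: (_ \in _); rewrite ler01 lexx.
  - move=> w _; rewrite indicE; have [Bw|Bw] := pselect (B w).
      by rewrite memNset ?/B//= Bw pow_county.
    by rewrite mem_set// -lee_fin pcK.
have PBC : P (~` B) = 1%E.
  apply/eqP; rewrite eq_le probability_le1//=; last exact: measurableC.
  rewrite -[leRHS]fineK ?fin_num_measure//; last exact: measurableC.
  rewrite lee_fin; apply/ler_addgt0Pr => e e0.
  (* The minimum keeps [e'] in the range of [PB]; dividing by [l + 1] gives [e' * l <= e] even when
     [l = 0]. *)
  pose e' := Num.min 1 (e / (l + 1)).
  have e'0 : 0 < e' by rewrite lt_min ltr01/= divr_gt0// ltr_wpDl.
  have e'l : e' * l <= e.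
    apply: (@le_trans _ _ (e / (l + 1) * l)); first by rewrite ler_wpM2r// ge_min lexx orbT.
    rewrite mulrAC ler_pdivrMr; last by rewrite ltr_wpDl.
    by rewrite ler_wpM2l ?(ltW e0)// lerDl.
  have := PB e'; rewrite e'0 ge_min lexx/= => /(_ isT); lra.
exists B; split => //.
  by rewrite -(setCK B) probability_setC ?PBC ?subee//; exact: measurableC.
move=> w /= /contra_notP; apply; rewrite /B/= /N /counting.
by case: asboolP.
Qed.

Lemma exponent_measureU A B : measurable A -> measurable B -> A `&` B = set0 ->
  exponent_measure (A `|` B) = (exponent_measure A + exponent_measure B)%E.
Proof.
move=> mA mB AB; have mAB : measurable (A `|` B) by exact: measurableU.
rewrite /exponent_measure -ge0_integralD//; last 4 first.
- by move=> x _; exact: exponent_term_ge0.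
- exact: measurable_exponent.
- by move=> x _; exact: exponent_term_ge0.
- exact: measurable_exponent.
apply: eq_integral => x _; rewrite -EFinD -mulrDl; congr (_ * _)%:E.
rewrite /cover_prob -RintegralD//.
- apply: eq_Rintegral => w _; rewrite !indicE in_setU.
  have [xA|] := boolP (_ \in A); have [xB|] := boolP (_ \in B);
    rewrite ?addr0 ?add0r//.
  move: xA xB; rewrite !inE => xA xB.
  by have : (A `&` B) (scale_point x (mark_pair w)) by []; rewrite AB.
- apply: unit_integrable => [|w]; last by rewrite indicE; case: (_ \in _); rewrite ler01 lexx.
  apply: (@measurableT_comp _ _ _ _ _ _ (\1_A : R * R -> R)); first exact: measurable_indic.
  by apply: measurable_scale_point => //; exact: measurable_mark_pair.
- apply: unit_integrable => [|w]; last by rewrite indicE; case: (_ \in _); rewrite ler01 lexx.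
  apply: (@measurableT_comp _ _ _ _ _ _ (\1_B : R * R -> R)); first exact: measurable_indic.
  by apply: measurable_scale_point => //; exact: measurable_mark_pair.
Qed.

(** The preimage is [A] halved. The factor 2 passes from the scaled mark to the radius [x], where
    [integral_inv2_double] applies. *)
Lemma exponent_measure_double A : measurable A ->
  exponent_measure (scale_point 2 @^-1` A) = (2%:E * exponent_measure A)%E.
Proof.
move=> mA; rewrite /exponent_measure -integral_inv2_double; last 2 first.
- exact: measurable_cover_prob.
- by move=> x; case/andP: (cover_prob01 x mA).
apply: eq_integral => x _; congr (_ * _)%:E; apply: eq_Rintegral => w _.
rewrite !indicE; congr (_%:R); congr nat_of_bool.
apply/idP/idP; rewrite !inE /preimage/= /scale_point/= !mulrA; done.
Qed.

(** After exchanging the integrals, a fixed mark with [c > 0] admits the radii from [t / c] on,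
    whose mass is [c / t]; the mean of [c] over the marks is 1. With a coordinate as [c] this gives
    the unit Fréchet margins. *)
Lemma exponent_measure_ge (c : R * R -> R) (t : R) : measurable_fun setT c ->
  (forall z x, c (scale_point z x) = z * c x) ->
  (forall w, 0 <= c (mark_pair w)) ->
  (\int[Q]_w (c (mark_pair w))%:E = 1)%E -> 0 < t ->
  exponent_measure [set x | t <= c x] = (t^-1)%:E.
Proof.
move=> mc cZ c0 c1 t0; pose A := [set x | t <= c x].
have mA : measurable A.
  rewrite (_ : A = c @^-1` `[t, +oo[%classic).
    by rewrite -[X in measurable X]setTI; exact: mc.
  by apply/seteqP; split => x /=; rewrite /A/= in_itv/= andbT.
have mD : measurable (`]0, +oo[%classic : set R) by exact: measurable_itv.
(* The intensity is extended by 0 so that Tonelli's theorem applies on the whole line. *)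
pose w2 := (fun x : R => x ^- 2) \_ `]0, +oo[%classic.
have mw2 : measurable_fun setT w2.
  exact: (iffLR (measurable_restrictT (fun x : R => x ^- 2) mD) (@measurable_inv2 R)).
have w20 x : 0 <= w2 x.
  by rewrite /w2 patchE; case: ifPn => // _; rewrite invr_ge0 sqr_ge0.
pose F (z : R * T') : \bar R := (w2 z.1 * \1_A (scale_point z.1 (mark_pair z.2)))%:E.
have F0 z : (0 <= F z)%E.
  by rewrite lee_fin mulr_ge0// indicE; case: (_ \in _).
have mind x : measurable_fun setT (fun w => \1_A (scale_point x (mark_pair w)) : R).
  apply: (@measurableT_comp _ _ _ _ _ _ (\1_A : R * R -> R)); first exact: measurable_indic.
  by apply: measurable_scale_point => //; exact: measurable_mark_pair.
have mF : measurable_fun setT F.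
  apply/measurable_EFinP; apply: measurable_funM.
    exact: (measurableT_comp mw2 measurable_fst).
  apply: (@measurableT_comp _ _ _ _ _ _ (\1_A : R * R -> R)); first exact: measurable_indic.
  apply: measurable_scale_point; first exact: measurable_fst.
  by apply: (measurableT_comp measurable_mark_pair); exact: measurable_snd.
transitivity (\int[lebesgue_measure]_x \int[Q]_w F (x, w))%E.
  rewrite /exponent_measure integral_mkcond; apply: eq_integral => x _.
  rewrite patchE; case: ifPn => xD; last first.
    rewrite integral0_eq// => w _.
    by rewrite /F/= /w2 patchE (negbTE xD) mul0r.
  transitivity (\int[Q]_w ((w2 x)%:E * (\1_A (scale_point x (mark_pair w)))%:E))%E; last first.
    by apply: eq_integral => w _; rewrite -EFinM.
  rewrite ge0_integralZl//; last 2 first.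
  - exact/measurable_EFinP.
  - by rewrite lee_fin.
  rewrite /w2 patchE xD EFinM muleC; congr (_ * _)%E.
  rewrite /cover_prob /Rintegral fineK//; apply: integrable_fin_num => //.
  by apply: unit_integrable => // w; rewrite indicE; case: (_ \in _); rewrite ler01 lexx.
rewrite (sfinite_Fubini lebesgue_measure Q F F0 mF).
transitivity (\int[Q]_w ((t^-1)%:E * (c (mark_pair w))%:E))%E; last first.
  rewrite ge0_integralZl//; last 3 first.
  - by apply/measurable_EFinP; exact: (measurableT_comp mc measurable_mark_pair).
  - by move=> w _; rewrite lee_fin.
  - by rewrite lee_fin invr_ge0 ltW.
  by rewrite c1 mule1.
apply: eq_integral => w _.
have := c0 w; rewrite le_eqVlt => /orP[/eqP cw0|cw].
  rewrite -cw0 mule0 integral0_eq// => x _; rewrite /F/= indicE memNset ?mulr0//.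
  by rewrite /A/= cZ -cw0 mulr0; apply/negP; rewrite -ltNge.
rewrite -EFinM.
have -> : t^-1 * c (mark_pair w) = (t / c (mark_pair w))^-1.
  by rewrite invf_div mulrC.
rewrite -integral_inv2_ge ?divr_gt0// [RHS]integral_mkcond; apply: eq_integral => x _.
rewrite patchE /F/= /w2 patchE indicE.
have -> : (scale_point x (mark_pair w) \in A) = (x \in `[t / c (mark_pair w), +oo[%classic).
  apply/idP/idP; rewrite !inE /A/= cZ in_itv/= andbT ler_pdivrMr//.
have [xt|xt] := boolP (x \in `[t / c (mark_pair w), +oo[%classic); last by rewrite mulr0.
rewrite mulr1 ifT//; move: xt; rewrite !inE/= !in_itv/= !andbT; apply: lt_le_trans.
by rewrite divr_gt0.
Qed.

End marked_points.

(** * Resampling argument on a finite grid *)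

Section grid_occupation.
Context {R : realFieldType} (n : nat).
Notation cell := ('I_n * 'I_n)%type.
Implicit Types (D S : {set cell}).

Definition top1 D : nat := \max_(c in D) c.1.
Definition top2 D : nat := \max_(c in D) c.2.

Definition concurrent D : bool := [exists c in D, (c.1 == top1 D :> nat) && (c.2 == top2 D :> nat)].

Definition avoids D S : bool := [forall c in D, c \notin S].

Lemma avoidsU D S1 S2 : avoids D (S1 :|: S2) = avoids D S1 && avoids D S2.
Proof.
apply/forall_inP/andP => [h|[/forall_inP h1 /forall_inP h2] c cD].
  by split; apply/forall_inP => c /h; rewrite inE negb_or => /andP[].
by rewrite inE negb_or h1// h2.
Qed.

Lemma avoids_setU D1 D2 S : avoids (D1 :|: D2) S = avoids D1 S && avoids D2 S.
Proof.
apply/forall_inP/andP => [h|[/forall_inP h1 /forall_inP h2] c].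
  by split; apply/forall_inP => c cD; apply: h; rewrite inE cD ?orbT.
by rewrite inE => /orP[/h1|/h2].
Qed.

Lemma le_top1 D c : c \in D -> (c.1 <= top1 D)%N.
Proof. by move=> cD; exact: (@leq_bigmax_cond _ (mem D) (fun b : cell => b.1 : nat) c). Qed.

Lemma le_top2 D c : c \in D -> (c.2 <= top2 D)%N.
Proof. by move=> cD; exact: (@leq_bigmax_cond _ (mem D) (fun b : cell => b.2 : nat) c). Qed.

Lemma top1_attained D : (0 < #|D|)%N -> exists2 c, c \in D & c.1 = top1 D :> nat.
Proof.
move=> D0; have := @eq_bigmax_cond _ (mem D) (fun c : cell => c.1 : nat).
by move=> /(_ D0)[c cD E]; exists c.
Qed.

Lemma top2_attained D : (0 < #|D|)%N -> exists2 c, c \in D & c.2 = top2 D :> nat.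
Proof.
move=> D0; have := @eq_bigmax_cond _ (mem D) (fun c : cell => c.2 : nat).
by move=> /(_ D0)[c cD E]; exists c.
Qed.

Lemma top1U D1 D2 : top1 (D1 :|: D2) = maxn (top1 D1) (top1 D2).
Proof.
apply/eqP; rewrite eqn_leq geq_max; apply/and3P; split.
- apply/bigmax_leqP => c; rewrite inE leq_max => /orP[/le_top1 ->//|/le_top1 ->].
  by rewrite orbT.
- by apply/bigmax_leqP => c cD; apply: le_top1; rewrite inE cD.
- by apply/bigmax_leqP => c cD; apply: le_top1; rewrite inE cD orbT.
Qed.

Lemma top2U D1 D2 : top2 (D1 :|: D2) = maxn (top2 D1) (top2 D2).
Proof.
apply/eqP; rewrite eqn_leq geq_max; apply/and3P; split.
- apply/bigmax_leqP => c; rewrite inE leq_max => /orP[/le_top2 ->//|/le_top2 ->].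
  by rewrite orbT.
- by apply/bigmax_leqP => c cD; apply: le_top2; rewrite inE cD.
- by apply/bigmax_leqP => c cD; apply: le_top2; rewrite inE cD orbT.
Qed.

(** Avoiding [beyond c] means staying in the lower left quadrant with corner [c]. Within that
    quadrant, the column and the row of [c] consist of [c], [below c] and [left_of c]. *)
Definition beyond (c : cell) : {set cell} := [set b : cell | (c.1 < b.1)%N || (c.2 < b.2)%N]%SET.
Definition below (c : cell) : {set cell} := [set b : cell | (b.1 == c.1) && (b.2 < c.2)%N]%SET.
Definition left_of (c : cell) : {set cell} := [set b : cell | (b.1 < c.1)%N && (b.2 == c.2)]%SET.

Lemma avoids_beyond D c :
  avoids D (beyond c) = (top1 D <= c.1)%N && (top2 D <= c.2)%N.
Proof.
apply/forall_inP/andP => [h|[/bigmax_leqP h1 /bigmax_leqP h2] b bD].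
  by split; apply/bigmax_leqP => b /h; rewrite inE negb_or -!leqNgt => /andP[].
by rewrite inE negb_or -!leqNgt h1// h2.
Qed.

(** The term of [c] is 1 exactly when [c] belongs to [D] and dominates it, which happens for at most
    one cell. The right-hand side is linear in avoidance indicators, so the mean of concurrence
    depends on avoidance probabilities only. *)
Lemma concurrentE D : (concurrent D)%:R =
  \sum_c ((avoids D (beyond c))%:R - (avoids D (beyond c :|: [set c]%SET))%:R) :> R.
Proof.
have termE c : (avoids D (beyond c))%:R - (avoids D (beyond c :|: [set c]%SET))%:R =
    (avoids D (beyond c) && (c \in D))%:R :> R.
  rewrite avoidsU; case: (avoids D (beyond c)) => /=; last by rewrite subrr.
  have -> : avoids D [set c]%SET = (c \notin D).
    apply/forall_inP/idP => [h|cD b bD]; first by apply/negP => /h; rewrite inE eqxx.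
    by rewrite inE; apply: contraNneq cD => <-.
  by case: (c \in D); rewrite /= ?subr0 ?subrr.
under eq_bigr do rewrite termE.
have topE c : avoids D (beyond c) && (c \in D) =
    [&& c \in D, c.1 == top1 D :> nat & c.2 == top2 D :> nat].
  rewrite andbC; apply: andb_id2l => cD; rewrite avoids_beyond.
  by rewrite !eqn_leq (le_top1 cD) (le_top2 cD).
under eq_bigr do rewrite topE.
rewrite /concurrent; case: existsP => [[c /andP[cD cE]]|h]; last first.
  by rewrite big1// => c _; case E: [&& _, _ & _] => //; exfalso; apply: h; exists c.
rewrite (bigD1 c)//= cD cE/= big1 ?addr0// => b bc.
case E: [&& _, _ & _] => //; move: E => /and3P[_ /eqP b1 /eqP b2].
move: cE bc => /andP[/eqP c1 /eqP c2]; rewrite -pair_eqE/= -!val_eqE/=.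
by rewrite b1 b2 c1 c2 !eqxx.
Qed.

(* When [D1] and [D2] stay within column [c.1] and row [c.2] and miss [c], the two factors are the
   signs of the differences of their tops (see [avoids_strip] and [sg_ltn]). *)
Definition imbalance D1 D2 (c : cell) : R :=
  (avoids D1 (beyond c :|: [set c]%SET))%:R * (avoids D2 (beyond c :|: [set c]%SET))%:R *
  ((avoids D2 (below c))%:R - (avoids D1 (below c))%:R) *
  ((avoids D2 (left_of c))%:R - (avoids D1 (left_of c))%:R).

Definition sign_product D1 D2 : R :=
  Num.sg ((top1 D1)%:R - (top1 D2)%:R) * Num.sg ((top2 D1)%:R - (top2 D2)%:R).

Definition tie D1 D2 : bool := (top1 D1 == top1 D2) || (top2 D1 == top2 D2).

(** In the quadrant of [c], a cell of [D] in the column of [c] is not [c] and not above it, hence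
    lies in [below c]. So [below c] is missed exactly when the top column comes before that of [c];
    likewise for rows. *)
Lemma avoids_strip D (c : cell) : (0 < #|D|)%N ->
  avoids D (beyond c :|: [set c]%SET) ->
  (avoids D (below c) = (top1 D < c.1)%N) * (avoids D (left_of c) = (top2 D < c.2)%N).
Proof.
move=> D0; rewrite avoidsU => /andP[]; rewrite avoids_beyond => /andP[t1 t2] /forall_inP cD.
have Dc b : b \in D -> b != c by move=> /cD; rewrite inE.
split.
- rewrite ltn_neqAle t1 andbT; apply/forall_inP/idP => [h|/eqP tc b bD].
    have [b bD b1] := top1_attained D0; have := h b bD; have := Dc b bD.
    rewrite inE negb_and -leqNgt -b1 -val_eqE/= => bc /orP[//|b2].
    move: bc; apply: contra => /eqP bc1.
    have := le_top2 bD => /leq_trans/(_ t2) b2'.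
    by rewrite -pair_eqE/= -!val_eqE/= bc1 eqxx eqn_leq b2'.
  rewrite inE negb_and; have [b1|//] := eqVneq b.1 c.1; rewrite -leqNgt/=.
  by exfalso; apply: tc; apply/eqP; rewrite eqn_leq t1 -b1 le_top1.
- rewrite ltn_neqAle t2 andbT; apply/forall_inP/idP => [h|/eqP tc b bD].
    have [b bD b2] := top2_attained D0; have := h b bD; have := Dc b bD.
    rewrite inE negb_and -leqNgt -b2 -val_eqE/= => bc /orP[b1|//].
    move: bc; apply: contra => /eqP bc2.
    have := le_top1 bD => /leq_trans/(_ t1) b1'.
    by rewrite -pair_eqE/= -!val_eqE/= bc2 eqxx eqn_leq b1' b1.
  rewrite inE negb_and; have [b2|//] := eqVneq b.2 c.2; rewrite ?orbT// -leqNgt/=.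
  by exfalso; apply: tc; apply/eqP; rewrite eqn_leq t2 -b2 le_top2.
Qed.

Lemma sg_ltn (a b J : nat) : maxn a b = J ->
  (b < J)%N%:R - (a < J)%N%:R = Num.sg (a%:R - b%:R) :> R.
Proof.
move=> <-; case: (ltngtP a b) => [ab|ba|->].
- by rewrite ltnn ab sub0r ltr0_sg// subr_lt0 ltr_nat.
- by rewrite ltnn ba subr0 gtr0_sg// subr_gt0 ltr_nat.
- by rewrite !subrr sgr0.
Qed.

(** Only the crossing cell [c] of the union can contribute to the sum. If [c] is empty, [imbalance]
    is the product of the signs and the last two terms vanish; if it is occupied, [imbalance]
    vanishes, and the set containing [c] attains both maxima, so the signs agree unless one of them
    is 0. *)
Lemma sign_product_decomposition D1 D2 : (0 < #|D1|)%N -> (0 < #|D2|)%N ->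
  sign_product D1 D2 = \sum_c imbalance D1 D2 c
    + (concurrent (D1 :|: D2))%:R - (concurrent (D1 :|: D2) && tie D1 D2)%:R.
Proof.
move=> D10 D20; set U := D1 :|: D2.
have U0 : (0 < #|U|)%N by apply: leq_trans D10 _; apply: subset_leq_card; exact: finset.subsetUl.
have [a1 a1U a1E] := top1_attained U0; have [a2 a2U a2E] := top2_attained U0.
pose c : cell := (a1.1, a2.2).
have tU1 : maxn (top1 D1) (top1 D2) = c.1 by rewrite -top1U a1E.
have tU2 : maxn (top2 D1) (top2 D2) = c.2 by rewrite -top2U a2E.
have cE : concurrent U = (c \in U).
  apply/existsP/idP => [[b /andP[bU /andP[/eqP b1 /eqP b2]]]|cU].
    rewrite (_ : c = b)//; apply/eqP; rewrite -pair_eqE/= -!val_eqE/=.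
    by rewrite a1E a2E b1 b2 !eqxx.
  by exists c; rewrite cU/= a1E a2E !eqxx.
(* If both sets avoid [b] and the cells beyond it, both tops come strictly before [b] in some
   coordinate, and the difference of indicators there is [1 - 1]. *)
have zero b : b != c -> imbalance D1 D2 b = 0.
  move=> bc; rewrite /imbalance.
  case E1: (avoids D1 _); rewrite ?mul0r//; case E2: (avoids D2 _); rewrite ?mulr0 ?mul0r//.
  have [-> ->] := avoids_strip D10 E1; have [-> ->] := avoids_strip D20 E2.
  move: E1 E2; rewrite !avoidsU !avoids_beyond => /andP[/andP[p1 p2] _] /andP[/andP[q1 q2] _].
  move: bc; rewrite -pair_eqE/= -!val_eqE/= negb_and => /orP[b1|b2].
    have : (maxn (top1 D1) (top1 D2) < b.1)%N.
      by rewrite tU1 ltn_neqAle eq_sym b1/= -tU1 geq_max p1 q1.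
    by rewrite gtn_max => /andP[-> ->]; rewrite subrr mulr0 mul0r.
  have : (maxn (top2 D1) (top2 D2) < b.2)%N.
    by rewrite tU2 ltn_neqAle eq_sym b2/= -tU2 geq_max p2 q2.
  by rewrite gtn_max => /andP[-> ->]; rewrite subrr mulr0.
rewrite (bigD1 c)//= big1 ?addr0; last by move=> b /zero.
rewrite cE; have [cU|cU] := boolP (c \in U); last first.
  rewrite subr0 addr0 /imbalance.
  have av1 : avoids D1 (beyond c :|: [set c]%SET).
    rewrite avoidsU avoids_beyond -tU1 -tU2 !leq_maxl/=.
    by apply/forall_inP => b bD; rewrite inE; apply: contraNneq cU => <-; rewrite inE bD.
  have av2 : avoids D2 (beyond c :|: [set c]%SET).
    rewrite avoidsU avoids_beyond -tU1 -tU2 !leq_maxr/=.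
    by apply/forall_inP => b bD; rewrite inE; apply: contraNneq cU => <-; rewrite inE bD orbT.
  rewrite av1 av2; have [-> ->] := avoids_strip D10 av1; have [-> ->] := avoids_strip D20 av2.
  by rewrite !mul1r (sg_ltn tU1) (sg_ltn tU2).
have -> : imbalance D1 D2 c = 0.
  rewrite /imbalance !avoidsU; move: cU; rewrite inE => /orP[cD|cD].
    have /negbTE -> : ~~ avoids D1 [set c]%SET.
      by apply/negP => /forall_inP/(_ c cD); rewrite inE eqxx.
    by rewrite andbF !mul0r.
  have /negbTE -> : ~~ avoids D2 [set c]%SET.
    by apply/negP => /forall_inP/(_ c cD); rewrite inE eqxx.
  by rewrite andbF mulr0 !mul0r.
rewrite add0r /sign_product /tie /=.
have [t1|t1] := eqVneq (top1 D1) (top1 D2); first by rewrite t1 subrr sgr0 mul0r subrr.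
have [t2|t2] := eqVneq (top2 D1) (top2 D2); first by rewrite t2 subrr sgr0 mulr0 subrr.
rewrite subr0 -(sg_ltn tU1) -(sg_ltn tU2).
have maxE (x y J : nat) : x != y -> maxn x y = J -> x = J -> (y < J)%N.
  by move=> xy m xJ; rewrite -xJ ltn_neqAle eq_sym xy xJ -m leq_maxr.
move: cU; rewrite inE => /orP[cD|cD].
  have x1 : top1 D1 = c.1 by apply/eqP; rewrite eqn_leq le_top1// -tU1 leq_maxl.
  have x2 : top2 D1 = c.2 by apply/eqP; rewrite eqn_leq le_top2// -tU2 leq_maxl.
  by rewrite (maxE _ _ _ t1 tU1 x1) (maxE _ _ _ t2 tU2 x2) x1 x2 !ltnn !subr0 mulr1.
have x1 : top1 D2 = c.1 by apply/eqP; rewrite eqn_leq le_top1// -tU1 leq_maxr.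
have x2 : top2 D2 = c.2 by apply/eqP; rewrite eqn_leq le_top2// -tU2 leq_maxr.
rewrite eq_sym in t1; rewrite eq_sym in t2; rewrite maxnC in tU1; rewrite maxnC in tU2.
rewrite (maxE _ _ _ t1 tU1 x1) (maxE _ _ _ t2 tU2 x2) x1 x2 !ltnn.
by rewrite !sub0r mulrNN mulr1.
Qed.

Variables (q q2 : {set cell} -> R).
(** Here [q] and [q2] stand for the laws of the occupied set of the process and of the doubled
    process. The hypotheses [qM] and [q2E] are all that the combinatorics needs to know of the
    Poisson structure. *)
Definition avoid_prob (r : {set cell} -> R) S : R := \sum_D r D * (avoids D S)%:R.
Hypothesis q_ge0 : forall D, 0 <= q D.
Hypothesis q_set0 : forall D, #|D| = 0%N -> q D = 0.
Hypothesis qM : forall S1 S2, (forall b, b \in S1 -> b \notin S2) ->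
  avoid_prob q (S1 :|: S2) = avoid_prob q S1 * avoid_prob q S2.
Hypothesis q2E : forall S, avoid_prob q2 S = avoid_prob q S ^+ 2.

(** With [q2E], the union of two independent sets of law [q] has the avoidance probabilities of
    [q2]. *)
Let sum2_avoids S : \sum_D1 \sum_D2 q D1 * q D2 * (avoids (D1 :|: D2) S)%:R = avoid_prob q S ^+ 2.
Proof.
rewrite expr2 /avoid_prob mulr_suml; apply: eq_bigr => D1 _.
rewrite mulr_sumr; apply: eq_bigr => D2 _.
by rewrite avoids_setU -mulnb natrM; ring.
Qed.

(* The occupation events of the disjoint sets [E], [L] and [M] are independent. *)
Let imbalance_mean0 c : \sum_D1 \sum_D2 q D1 * q D2 * imbalance D1 D2 c = 0.
Proof.
set E := beyond c :|: [set c]%SET; set L := below c; set M := left_of c.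
have dEL b : b \in E -> b \notin L.
  rewrite !inE -pair_eqE/= negb_and -val_eqE/= -leqNgt.
  by move=> /orP[/orP[/gtn_eqF ->|/ltnW ->]|/andP[_ /eqP ->]]; rewrite ?leqnn ?orbT.
have dEM b : b \in E -> b \notin M.
  rewrite !inE -pair_eqE/= negb_and -!val_eqE/= -leqNgt.
  by move=> /orP[/orP[/ltnW ->|/gtn_eqF ->]|/andP[/eqP -> _]]; rewrite ?leqnn ?orbT.
have dELM b : b \in E :|: L -> b \notin M.
  rewrite inE => /orP[/dEM //|]; rewrite !inE => /andP[/eqP -> _].
  by rewrite ltnn.
pose e := avoid_prob q E; pose l := avoid_prob q L; pose m := avoid_prob q M.
pose u D : R := (avoids D E)%:R.
have sE : \sum_D q D * u D = e by [].
have sEL : \sum_D q D * (u D * (avoids D L)%:R) = e * l.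
  by rewrite -qM//; apply: eq_bigr => D _; rewrite avoidsU -mulnb natrM.
have sEM : \sum_D q D * (u D * (avoids D M)%:R) = e * m.
  by rewrite -qM//; apply: eq_bigr => D _; rewrite avoidsU -mulnb natrM.
have sELM : \sum_D q D * (u D * (avoids D L)%:R * (avoids D M)%:R) = e * l * m.
  rewrite /e /l /m -(qM dEL) -(qM dELM); apply: eq_bigr => D _.
  by rewrite [in RHS]avoidsU [avoids D (E :|: L)]avoidsU -!mulnb !natrM.
have dsum (f g : {set cell} -> R) :
    \sum_D1 \sum_D2 (q D1 * f D1) * (q D2 * g D2) = (\sum_D q D * f D) * (\sum_D q D * g D).
  by rewrite mulr_suml; apply: eq_bigr => D1 _; rewrite mulr_sumr.
(* Each of the four products has mean [e ^+ 2 * l * m], with two signs of each kind. *)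
transitivity (\sum_D1 \sum_D2
   ((q D1 * u D1) * (q D2 * (u D2 * (avoids D2 L)%:R * (avoids D2 M)%:R))
  + (q D1 * (u D1 * (avoids D1 L)%:R * (avoids D1 M)%:R)) * (q D2 * u D2)
  - (q D1 * (u D1 * (avoids D1 M)%:R)) * (q D2 * (u D2 * (avoids D2 L)%:R))
  - (q D1 * (u D1 * (avoids D1 L)%:R)) * (q D2 * (u D2 * (avoids D2 M)%:R)))).
  by apply: eq_bigr => D1 _; apply: eq_bigr => D2 _; rewrite /imbalance /u; ring.
under eq_bigr do rewrite !sumrB big_split/=.
rewrite !sumrB big_split/= !dsum sE sEL sEM sELM; ring.
Qed.

(** By [concurrentE] the mean of concurrence under [q2] is that of the union. The decomposition then
    leaves, as exact difference, the weight of the pairs that are both concurrent and tied. *)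
Lemma sign_product_mean :
  `| \sum_D1 \sum_D2 q D1 * q D2 * sign_product D1 D2 - \sum_D q2 D * (concurrent D)%:R |
  <= \sum_D1 \sum_D2 q D1 * q D2 * (tie D1 D2)%:R.
Proof.
have E2 : \sum_D q2 D * (concurrent D)%:R =
    \sum_D1 \sum_D2 q D1 * q D2 * (concurrent (D1 :|: D2))%:R.
  transitivity (\sum_c (avoid_prob q2 (beyond c) - avoid_prob q2 (beyond c :|: [set c]%SET))).
    under eq_bigr do rewrite concurrentE mulr_sumr.
    rewrite exchange_big/=; apply: eq_bigr => c _.
    by rewrite /avoid_prob -sumrB; apply: eq_bigr => D _; rewrite mulrBr.
  under eq_bigr do rewrite !q2E -!sum2_avoids -sumrB.
  rewrite exchange_big/=; apply: eq_bigr => D1 _.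
  under eq_bigr do rewrite -sumrB.
  rewrite exchange_big/=; apply: eq_bigr => D2 _.
  by rewrite concurrentE mulr_sumr; apply: eq_bigr => c _; rewrite mulrBr.
have E1 : \sum_D1 \sum_D2 q D1 * q D2 * sign_product D1 D2 =
    \sum_D1 \sum_D2 q D1 * q D2 * (concurrent (D1 :|: D2))%:R
    - \sum_D1 \sum_D2 q D1 * q D2 * (concurrent (D1 :|: D2) && tie D1 D2)%:R.
  (* The vanishing means of [imbalance] are put back so that the decomposition applies term by term;
     pairs with an empty set have weight 0. *)
  have <- : \sum_c \sum_D1 \sum_D2 q D1 * q D2 * imbalance D1 D2 c +
     (\sum_D1 \sum_D2 q D1 * q D2 * (concurrent (D1 :|: D2))%:R
    - \sum_D1 \sum_D2 q D1 * q D2 * (concurrent (D1 :|: D2) && tie D1 D2)%:R) = 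
     \sum_D1 \sum_D2 q D1 * q D2 * (concurrent (D1 :|: D2))%:R
    - \sum_D1 \sum_D2 q D1 * q D2 * (concurrent (D1 :|: D2) && tie D1 D2)%:R.
    by rewrite big1 ?add0r// => c _; exact: imbalance_mean0.
  rewrite -sumrB [X in _ = X + _]exchange_big/= -big_split/=; apply: eq_bigr => D1 _.
  rewrite -sumrB [X in _ = X + _]exchange_big/= -big_split/=; apply: eq_bigr => D2 _.
  rewrite -mulr_sumr.
  have [D10|] := posnP #|D1|; first by rewrite q_set0// !mul0r subrr addr0.
  have [D20|] := posnP #|D2|; first by rewrite (q_set0 D20) mulr0 !mul0r subrr addr0.
  by move=> D20 D10; rewrite sign_product_decomposition//; ring.
rewrite E1 E2 addrC addKr normrN ger0_norm.
  apply: ler_sum => D1 _; apply: ler_sum => D2 _; rewrite ler_wpM2l ?mulr_ge0//.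
  by rewrite ler_nat; case: (concurrent _).
by apply: sumr_ge0 => D1 _; apply: sumr_ge0 => D2 _; rewrite !mulr_ge0.
Qed.

End grid_occupation.

(** * Refining the grid *)

Section grid.
Context {R : realType}.
Implicit Types (x y t : R) (n : nat).

(* The distribution function of each [eta s]. Cutting at its quantiles gives all columns and all
   rows of the grid the same probability [n.+1%:R^-1] of being the top one, which bounds the
   probability of a tie. *)
Definition frechet x : R := if 0 < x then expR (- x^-1) else 0.

Definition level n x : nat := Num.truncn (n.+1%:R * frechet x).

(** [inord] never falls back on its default value, because [frechet < 1] keeps the levels at most
    [n]. *)
Definition gcell n (x : R * R) : 'I_n.+1 * 'I_n.+1 :=
  (inord (level n x.1), inord (level n x.2)).

Lemma frechet_ge0 x : 0 <= frechet x.
Proof. by rewrite /frechet; case: ifP => // _; exact: expR_ge0. Qed.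

Lemma frechet_lt1 x : frechet x < 1.
Proof.
by rewrite /frechet; case: ifP => // x0; rewrite expR_lt1 oppr_lt0 invr_gt0.
Qed.

Lemma lt_frechet x y : 0 <= x -> x < y -> frechet x < frechet y.
Proof.
move=> x0 xy; have y0 := le_lt_trans x0 xy; rewrite /frechet y0.
case: ifP => [x0'|_]; last exact: expR_gt0.
by rewrite ltr_expR ltrN2 ltf_pV2.
Qed.

Lemma le_frechet x y : x <= y -> frechet x <= frechet y.
Proof.
move=> xy; have [x0|x0] := ltP 0 x; last first.
  by rewrite {1}/frechet ltNge x0/= frechet_ge0.
move: xy; rewrite le_eqVlt => /orP[/eqP -> //|xy].
by rewrite ltW// lt_frechet// ltW.
Qed.

Lemma measurable_frechet : measurable_fun setT frechet.
Proof.
have mD : measurable (`]0, +oo[%classic : set R) by exact: measurable_itv.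
have mf : measurable_fun (`]0, +oo[%classic : set R) (fun x => expR (- x^-1)).
  apply: open_continuous_measurable_fun; first exact: interval_open.
  move=> x; rewrite inE/= in_itv/= andbT => x0.
  apply: continuous_comp; last exact: continuous_expR.
  by apply: continuousN; apply: cvgV; [rewrite gt_eqF|exact: cvg_id].
have := iffLR (measurable_restrictT _ mD) mf; congr (measurable_fun _ _).
apply/funext => x; rewrite patchE /frechet.
by congr (if _ then _ else _); apply/idP/idP; rewrite inE/= in_itv/= andbT.
Qed.

Lemma ltn_level n x : (level n x < n.+1)%N.
Proof.
rewrite truncn_lt_nat ?mulr_ge0 ?frechet_ge0//.
by rewrite -[ltRHS]mulr1 ltr_pM2l// frechet_lt1.
Qed.

Lemma le_level n x y : x <= y -> (level n x <= level n y)%N.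
Proof. by move=> xy; apply: le_truncn; rewrite ler_pM2l// le_frechet. Qed.

(** Once [n.+1] times the gap between the two Fréchet values exceeds 1, the integer parts differ.
    Nonnegativity of [x] matters, [frechet] being constant on the negative half-line. *)
Lemma lt_level x y : 0 <= x -> x < y -> \forall n \near \oo, (level n x < level n y)%N.
Proof.
move=> x0 /(lt_frechet x0) xy; pose e := frechet y - frechet x.
have e0 : 0 < e by rewrite subr_gt0.
exists (Num.truncn (e^-1)) => // n /= ne.
have en : 1 < n.+1%:R * e.
  by rewrite mulrC -ltr_pdivrMl// mulr1 (lt_le_trans (truncnS_gt _))// ler_nat ltnS.
rewrite /level truncn_gt_nat (le_trans _ (ltW _ : n.+1%:R * frechet x + 1 <= _))//.
  by rewrite -natr1 lerD2r truncn_le mulr_ge0// frechet_ge0.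
by rewrite addrC -ltrBrDr -mulrBr.
Qed.

Lemma gcell1 n (x : R * R) : (gcell n x).1 = level n x.1 :> nat.
Proof. by rewrite inordK// ltn_level. Qed.

Lemma gcell2 n (x : R * R) : (gcell n x).2 = level n x.2 :> nat.
Proof. by rewrite inordK// ltn_level. Qed.

Lemma measurable_level n (j : nat) : measurable [set x : R | level n x = j].
Proof.
rewrite (_ : mkset _ = frechet @^-1` `[j%:R / n.+1%:R, j.+1%:R / n.+1%:R[%classic).
  by rewrite -[X in measurable X]setTI; exact: measurable_frechet.
apply/seteqP; split => x; rewrite /= in_itv/= ler_pdivrMr// ltr_pdivlMr// [_ * n.+1%:R]mulrC.
  by move=> <-; rewrite truncn_itv// mulr_ge0// frechet_ge0.
exact: truncn_def.
Qed.

Lemma measurable_gcell n (p : pred ('I_n.+1 * 'I_n.+1)) :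
  measurable [set x : R * R | p (gcell n x)].
Proof.
rewrite (_ : mkset _ = \bigcup_(c in [set c | p c])
   (fst @^-1` [set x | level n x = c.1] `&` snd @^-1` [set x | level n x = c.2])).
  apply: fin_bigcup_measurable => // c _; apply: measurableI.
    by rewrite -[X in measurable X]setTI; apply: measurable_fst => //; exact: measurable_level.
  by rewrite -[X in measurable X]setTI; apply: measurable_snd => //; exact: measurable_level.
apply/seteqP; split => [x /= px|x /= [c /= pc [c1 c2]]].
  by exists (gcell n x); rewrite //= gcell1 gcell2.
have -> // : gcell n x = c.
by apply/eqP; rewrite -pair_eqE/= -!val_eqE/= gcell1 gcell2 c1 c2 !eqxx.
Qed.

Definition frechet_inv (p : R) : R := (- ln p)^-1.

Lemma frechet_inv_gt0 p : 0 < p < 1 -> 0 < frechet_inv p.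
Proof. by move=> p01; rewrite invr_gt0 oppr_gt0 ln_lt0. Qed.

Lemma frechet_ge_inv p x : 0 < p < 1 -> (p <= frechet x) = (frechet_inv p <= x).
Proof.
move=> p01; have t0 := frechet_inv_gt0 p01; have /andP[p0 p1] := p01.
rewrite /frechet; have [x0|x0] := ltP 0 x; last first.
  by rewrite [LHS]leNgt p0 [RHS]leNgt (le_lt_trans x0 t0).
rewrite -{1}[p](@lnK R p) ?posrE// ler_expR lerNr /frechet_inv.
by rewrite -[x in RHS]invrK lef_pV2 ?posrE ?invr_gt0 ?oppr_gt0 ?ln_lt0.
Qed.

(** The union of the columns from [j] on is thus a half-plane bounded by a Fréchet quantile, whose
    exponent measure is explicit. *)
Lemma le_levelE n (j : nat) x : (0 < j < n.+1)%N ->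
  (j <= level n x)%N = (frechet_inv (j%:R / n.+1%:R) <= x).
Proof.
move=> /andP[j0 jn]; rewrite /level truncn_ge_nat ?mulr_ge0 ?frechet_ge0//.
rewrite -frechet_ge_inv ?ler_pdivrMr// 1?mulrC//.
by rewrite mulrC divr_gt0 ?ltr0n// ltr_pdivrMr// mul1r ltr_nat.
Qed.

End grid.

(** * Trace of a point configuration on the grid *)

Section occupied_cells.
Context {R : realType} (n : nat).
Implicit Types (f : nat -> R * R) (S : {set 'I_n.+1 * 'I_n.+1}).

Definition occupied f : {set 'I_n.+1 * 'I_n.+1} :=
  [set c | `[< exists i, gcell n (f i) = c >]]%SET.

Lemma gcell_occupied f i : gcell n (f i) \in occupied f.
Proof. by rewrite inE; apply/asboolP; exists i. Qed.

Lemma occupiedP f c : reflect (exists i, gcell n (f i) = c) (c \in occupied f).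
Proof. by rewrite inE; exact: asboolP. Qed.

Lemma occupied_gt0 f : (0 < #|occupied f|)%N.
Proof. by apply/card_gt0P; exists (gcell n (f 0%N)); exact: gcell_occupied. Qed.

Lemma avoids_occupied f S :
  avoids (occupied f) S = `[< forall i, gcell n (f i) \notin S >].
Proof.
apply/forall_inP/asboolP => [h i|h c /occupiedP[i <-]//].
by apply: h; exact: gcell_occupied.
Qed.

Lemma top1_occupied f (m : R) : (forall i, (f i).1 <= m) -> (exists i, (f i).1 = m) ->
  top1 (occupied f) = level n m.
Proof.
move=> fm [i fi]; apply/eqP; rewrite eqn_leq; apply/andP; split.
  by apply/bigmax_leqP => c /occupiedP[j <-]; rewrite gcell1 le_level.
by rewrite -fi -gcell1; apply: le_top1; exact: gcell_occupied.
Qed.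

Lemma top2_occupied f (m : R) : (forall i, (f i).2 <= m) -> (exists i, (f i).2 = m) ->
  top2 (occupied f) = level n m.
Proof.
move=> fm [i fi]; apply/eqP; rewrite eqn_leq; apply/andP; split.
  by apply/bigmax_leqP => c /occupiedP[j <-]; rewrite gcell2 le_level.
by rewrite -fi -gcell2; apply: le_top2; exact: gcell_occupied.
Qed.

Lemma concurrent_occupied f (m1 m2 : R) :
  top1 (occupied f) = level n m1 -> top2 (occupied f) = level n m2 ->
  concurrent (occupied f) =
  `[< exists i, level n (f i).1 = level n m1 /\ level n (f i).2 = level n m2 >].
Proof.
move=> t1 t2; apply/existsP/asboolP => [[c /andP[/occupiedP[i <-]]]|[i [i1 i2]]].
  by rewrite gcell1 gcell2 t1 t2 => /andP[/eqP ? /eqP ?]; exists i.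
by exists (gcell n (f i)); rewrite gcell_occupied gcell1 gcell2 t1 t2 i1 i2 !eqxx.
Qed.

End occupied_cells.

(** * Probability of a tie *)

Section tie_probability.
Context {R : realFieldType} (n : nat).
Implicit Types (D S : {set 'I_n * 'I_n}).
Variable q : {set 'I_n * 'I_n} -> R.
Hypothesis q_ge0 : forall D, 0 <= q D.
Hypothesis q_set0 : forall D, #|D| = 0%N -> q D = 0.
Hypothesis q_sum : \sum_D q D = 1.

Definition from1 (j : nat) : {set 'I_n * 'I_n} := [set c : 'I_n * 'I_n | (j <= c.1)%N]%SET.
Definition from2 (j : nat) : {set 'I_n * 'I_n} := [set c : 'I_n * 'I_n | (j <= c.2)%N]%SET.

Lemma avoids_from1 D j : (0 < #|D|)%N -> avoids D (from1 j) = (top1 D < j)%N.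
Proof.
move=> D0; apply/forall_inP/idP => [h|Dj c cD]; last first.
  by rewrite inE -ltnNge (leq_ltn_trans (le_top1 cD)).
have [c cD <-] := top1_attained D0.
by have := h c cD; rewrite inE -ltnNge.
Qed.

Lemma avoids_from2 D j : (0 < #|D|)%N -> avoids D (from2 j) = (top2 D < j)%N.
Proof.
move=> D0; apply/forall_inP/idP => [h|Dj c cD]; last first.
  by rewrite inE -ltnNge (leq_ltn_trans (le_top2 cD)).
have [c cD <-] := top2_attained D0.
by have := h c cD; rewrite inE -ltnNge.
Qed.

Let ltn_split (t j : nat) : (t == j)%:R = (t < j.+1)%:R - (t < j)%:R :> R.
Proof. by rewrite ltnS; case: ltngtP => _; rewrite ?subrr ?subr0. Qed.

(** For nonempty [D], avoiding the columns from [j] on means that the top column comes before [j];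
    empty sets have weight 0. *)
Lemma prob_top1 j : \sum_D q D * (top1 D == j)%:R =
  avoid_prob q (from1 j.+1) - avoid_prob q (from1 j).
Proof.
rewrite /avoid_prob -sumrB; apply: eq_bigr => D _.
have [D0|D0] := posnP #|D|; first by rewrite q_set0// !mul0r subrr.
by rewrite !avoids_from1// -mulrBr ltn_split.
Qed.

Lemma prob_top2 j : \sum_D q D * (top2 D == j)%:R =
  avoid_prob q (from2 j.+1) - avoid_prob q (from2 j).
Proof.
rewrite /avoid_prob -sumrB; apply: eq_bigr => D _.
have [D0|D0] := posnP #|D|; first by rewrite q_set0// !mul0r subrr.
by rewrite !avoids_from2// -mulrBr ltn_split.
Qed.

(** Given [D1], a tie forces the top column or the top row of [D2] to a prescribed value, each with
    probability at most [r]. *)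
Lemma tie_prob_le (r : R) :
  (forall j, \sum_D q D * (top1 D == j)%:R <= r) ->
  (forall j, \sum_D q D * (top2 D == j)%:R <= r) ->
  \sum_D1 \sum_D2 q D1 * q D2 * (tie D1 D2)%:R <= r + r.
Proof.
move=> r1 r2.
apply: (@le_trans _ _ (\sum_D1 q D1 * (\sum_D2 q D2 * (top1 D2 == top1 D1)%:R +
                                      \sum_D2 q D2 * (top2 D2 == top2 D1)%:R))).
  apply: ler_sum => D1 _; rewrite -big_split/= mulr_sumr; apply: ler_sum => D2 _.
  rewrite -mulrA -mulrDr; apply: ler_wpM2l => //; apply: ler_wpM2l => //.
  rewrite /tie [top1 D1 == _]eq_sym [top2 D1 == _]eq_sym -natrD ler_nat.
  by case: (_ == _); case: (_ == _).
apply: (@le_trans _ _ (\sum_D1 q D1 * (r + r))).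
  by apply: ler_sum => D1 _; rewrite ler_wpM2l// lerD.
by rewrite -mulr_suml q_sum mul1r.
Qed.

End tie_probability.

Section finite_valued.
Context {R : realType} d {T : measurableType d} (P : probability T R).

Lemma Rintegral_finite_valued (I : finType) (Z : T -> I) (g : I -> R) :
  (forall i, measurable [set w | Z w = i]) ->
  \int[P]_w g (Z w) = \sum_i fine (P [set w | Z w = i]) * g i.
Proof.
move=> mZ; under [RHS]eq_bigr do rewrite mulrC.
rewrite -Rintegral_simple//; apply: eq_Rintegral => w _.
rewrite (bigD1 (Z w))//= indicE mem_set//= mulr1 big1 ?addr0// => i iZ.
by rewrite indicE memNset ?mulr0//= => Zi; rewrite Zi eqxx in iZ.
Qed.

Lemma measurable_finite_valued (I : finType) (Z : T -> I) (g : I -> R) :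
  (forall i, measurable [set w | Z w = i]) -> measurable_fun setT (fun w => g (Z w)).
Proof.
move=> mZ; rewrite (_ : (fun w => _) = fun w => \sum_i g i * \1_[set w | Z w = i] w).
  by apply: measurable_sum => i; apply: measurable_funM => //; exact: measurable_indic.
apply/funext => w; rewrite (bigD1 (Z w))//= indicE mem_set//= mulr1 big1 ?addr0// => i iZ.
by rewrite indicE memNset ?mulr0//= => Zi; rewrite Zi eqxx in iZ.
Qed.

Variable n : nat.
Variable f : nat -> T -> R * R.
Hypothesis mf : forall i, measurable_fun setT (f i).

Lemma measurable_avoiding (S : {set 'I_n.+1 * 'I_n.+1}) :
  measurable [set w | forall i, gcell n (f i w) \notin S].
Proof.
rewrite (_ : mkset _ = \bigcap_i (f i @^-1` [set x | gcell n x \notin S])).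
  apply: bigcapT_measurable => i; rewrite -[X in measurable X]setTI; apply: mf => //.
  exact: (measurable_gcell (fun c => c \notin S)).
by apply/seteqP; split => w /= h i; [move=> _; exact: h|exact: (h i)].
Qed.

Lemma measurable_occupied (D : {set 'I_n.+1 * 'I_n.+1}) :
  measurable [set w | occupied n (f ^~ w) = D].
Proof.
have mc c : measurable [set w | c \in occupied n (f ^~ w)].
  rewrite (_ : mkset _ = ~` [set w | forall i, gcell n (f i w) \notin [set c]%SET]).
    by apply: measurableC; exact: measurable_avoiding.
  apply/seteqP; split => w /=.
    by move=> /occupiedP[i <-] /(_ i); rewrite inE eqxx.
  by move=> /existsNP[i /negP]; rewrite negbK inE => /eqP <-; exact: gcell_occupied.
rewrite (_ : mkset _ = \bigcap_(c in [set: 'I_n.+1 * 'I_n.+1])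
    [set w | (c \in occupied n (f ^~ w)) = (c \in D)]).
  apply: fin_bigcap_measurable => // c _; case: (c \in D); first exact: mc.
  rewrite (_ : mkset _ = ~` [set w | c \in occupied n (f ^~ w)]).
    by apply: measurableC; exact: mc.
  by apply/seteqP; split => w /=; [move=> ->|move=> /negP/negbTE].
apply/seteqP; split => w /=; first by move=> <-.
by move=> h; apply/setP => c; exact: h.
Qed.

Definition occupied_prob (D : {set 'I_n.+1 * 'I_n.+1}) : R :=
  fine (P [set w | occupied n (f ^~ w) = D]).

Lemma occupied_prob_ge0 D : 0 <= occupied_prob D.
Proof. by rewrite fine_ge0. Qed.

Lemma occupied_prob0 (D : {set 'I_n.+1 * 'I_n.+1}) : #|D| = 0%N -> occupied_prob D = 0.
Proof.
move=> D0; rewrite /occupied_prob (_ : mkset _ = set0) ?measure0//.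
by apply/seteqP; split => w //= E; have := occupied_gt0 n (f ^~ w); rewrite E D0.
Qed.

Lemma occupied_prob_mean (g : {set 'I_n.+1 * 'I_n.+1} -> R) :
  \sum_D occupied_prob D * g D = \int[P]_w g (occupied n (f ^~ w)).
Proof. by rewrite Rintegral_finite_valued//; exact: measurable_occupied. Qed.

Lemma avoid_occupied_prob S : avoid_prob occupied_prob S =
  fine (P [set w | forall i, gcell n (f i w) \notin S]).
Proof.
rewrite /avoid_prob occupied_prob_mean -Rintegral_indic; last exact: measurable_avoiding.
apply: eq_Rintegral => w _; rewrite indicE avoids_occupied.
congr (_%:R); congr nat_of_bool; apply/asboolP/idP; by rewrite inE.
Qed.

Lemma sum_occupied_prob : \sum_D occupied_prob D = 1.
Proof.
transitivity (\sum_D occupied_prob D * 1); first by under [RHS]eq_bigr do rewrite mulr1.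
rewrite (occupied_prob_mean (fun=> 1)) Rintegral_cst// mul1r.
by rewrite -[RHS]/(fine 1%E); congr fine; exact: probability_setT.
Qed.

End finite_valued.

(** * Vanishing mesh and conclusion *)

Section concurrence.
Context {R : realType} d {T : measurableType d} (P : probability T R).
Context (k : nat) (X : set 'rV[R]_k).
Context d' {T' : measurableType d'} (Q : probability T' R).
Variables (Y : 'rV[R]_k -> T' -> R) (zeta : nat -> T -> R)
  (Yi : nat -> 'rV[R]_k -> T -> R) (eta eta' : 'rV[R]_k -> T -> R).
Hypothesis hY : spectral_process Q X Y.
Hypothesis heta : spectral_representation P X Q Y zeta Yi eta.
Hypothesis heta' : independent_copy P X eta eta'.
Variables (s1 s2 : 'rV[R]_k).
Hypotheses (Xs1 : X s1) (Xs2 : X s2).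

Let mY : measurable_family X Y. Proof. by have [[]] := hY. Qed.

Let hzeta : poisson_points P `]0, +oo[%classic (fun x => x ^- 2) zeta.
Proof. by have [] := heta. Qed.

Let hYi : independent_copies P X Q Y Yi.
Proof. by have [] := heta. Qed.

Let hind : independent2 P (sigma_family setT zeta)
  (sigma_family [set p : nat * 'rV[R]_k | X p.2] (fun p => Yi p.1 p.2)).
Proof. by have [] := heta. Qed.

Let meta : measurable_family X eta.
Proof. by have [_ _ _ []] := heta. Qed.

Let meta' : measurable_family X eta'.
Proof. by have [] := heta'. Qed.

Let phi : nat -> T -> R * R := spectral_pair zeta Yi s1 s2.
Let phi2 i w : R * R := scale_point 2 (phi i w).
Let Lambda := exponent_measure Q Y s1 s2.

Let mphi i : measurable_fun setT (phi i).
Proof. exact: measurable_spectral_pair Xs1 Xs2 hzeta hYi i. Qed.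

Let mphi2 i : measurable_fun setT (phi2 i).
Proof. by apply: measurable_scale_point => //; exact: mphi. Qed.

Let phi_ge0 i w : 0 <= (phi i w).1 /\ 0 <= (phi i w).2.
Proof.
have [_ /(_ i w) z0 _ _] := hzeta; move: z0; rewrite /= in_itv/= andbT => /ltW z0.
have [/(_ i)[_ Y0 _] _ _] := hYi.
by split; rewrite mulr_ge0// Y0.
Qed.

Let avoid A : measurable A -> P [set w | forall i, ~ A (phi i w)] = expeR (- Lambda A).
Proof. exact: avoidance Xs1 Xs2 mY hzeta hYi hind _. Qed.

Let Lambda_ge0 A : measurable A -> (0 <= Lambda A)%E.
Proof. exact: exponent_measure_ge0 Xs1 Xs2 mY _. Qed.

Let mean_mark s : X s -> (\int[Q]_w (Y s w)%:E = 1)%E.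
Proof. by move=> Xs; have [_ /(_ s Xs) + _] := hY; rewrite unlock. Qed.

Let Lambda_ge1 t : 0 < t -> Lambda [set x | t <= x.1] = (t^-1)%:E.
Proof.
move=> t0; apply: (exponent_measure_ge Xs1 Xs2 mY (c := fst)) => //.
- by move=> w; have [[_ + _] _ _] := hY; apply.
- exact: mean_mark.
Qed.

Let Lambda_ge2 t : 0 < t -> Lambda [set x | t <= x.2] = (t^-1)%:E.
Proof.
move=> t0; apply: (exponent_measure_ge Xs1 Xs2 mY (c := snd)) => //.
- by move=> w; have [[_ + _] _ _] := hY; apply.
- exact: mean_mark.
Qed.

Section fixed_grid.
Variable n : nat.
Notation cell := ('I_n.+1 * 'I_n.+1)%type.
Implicit Types (S D : {set cell}).

Let q := @occupied_prob _ _ _ P n phi.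
Let q2 := @occupied_prob _ _ _ P n phi2.
Let cells S : set (R * R) := [set x | gcell n x \in S].

Let mcells S : measurable (cells S).
Proof. exact: (measurable_gcell (fun c => c \in S)). Qed.

Let avoid_q S : avoid_prob q S = fine (expeR (- Lambda (cells S))).
Proof.
rewrite avoid_occupied_prob; last exact: mphi.
rewrite -avoid//; congr (fine (P _)).
by apply/seteqP; split => w /= h i; [exact/negP|apply/negP; exact: h].
Qed.

Let expeR_fin (x : \bar R) : (0 <= x)%E -> expeR (- x) \is a fin_num.
Proof. by case: x. Qed.

Let avoid_qM S1 S2 : (forall b, b \in S1 -> b \notin S2) ->
  avoid_prob q (S1 :|: S2) = avoid_prob q S1 * avoid_prob q S2.
Proof.
move=> S12; rewrite !avoid_q.
have -> : cells (S1 :|: S2) = cells S1 `|` cells S2.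
  by apply/seteqP; split => x; rewrite /cells/= inE => /orP.
rewrite {1}/Lambda (exponent_measureU Q Xs1 Xs2 mY)//; last first.
  by rewrite -subset0 => x [/S12 /negP].
rewrite oppeD; last by apply: ge0_adde_def; rewrite inE Lambda_ge0.
by rewrite expeRD fineM ?expeR_fin// Lambda_ge0.
Qed.

(** The doubled process avoids the cells exactly when [phi] avoids the halved cells, whose intensity
    is twice as large; doubling the exponent squares the probability. *)
Let avoid_q2 S : avoid_prob q2 S = avoid_prob q S ^+ 2.
Proof.
rewrite avoid_q avoid_occupied_prob; last exact: mphi2.
have m2 : measurable (scale_point 2 @^-1` cells S).
  rewrite -[X in measurable X]setTI.
  have m2 : measurable_fun setT (scale_point 2 : R * R -> R * R).
    by apply: (@measurable_scale_point R _ (R * R)%type (fun=> 2) id).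
  by apply: m2 => //; exact: mcells.
transitivity (fine (P [set w | forall i, ~ (scale_point 2 @^-1` cells S) (phi i w)])).
  congr (fine (P _)).
  apply/seteqP; split => w /= h i; first by move=> hS; have /negP := h i; apply.
  by apply/negP => hS; exact: (h i).
rewrite avoid// /Lambda (exponent_measure_double Q Xs1 Xs2 mY)// -/Lambda.
rewrite (_ : 2%:E * _ = Lambda (cells S) + Lambda (cells S))%E; last first.
  by rewrite -[2]/(1 + 1) EFinD ge0_muleDl// mul1e.
rewrite oppeD; last by apply: ge0_adde_def; rewrite inE Lambda_ge0.
by rewrite expeRD fineM ?expeR_fin ?Lambda_ge0// expr2.
Qed.

Let q_sum : \sum_D q D = 1.
Proof. by apply: sum_occupied_prob; exact: mphi. Qed.

(** At the quantile [t] of order [p] the avoidance probability [expR (- t^-1)] is [p]. The ends are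
    outside the range of [le_levelE]: for [j = 0] every cell is excluded, for [j = n.+1] none is. *)
Let avoid_from j (from : nat -> {set cell}) (c : R * R -> R) :
  (forall t, 0 < t -> Lambda [set x | t <= c x] = (t^-1)%:E) ->
  (forall j, cells (from j) = [set x | (j <= level n (c x))%N]) ->
  (j <= n.+1)%N -> avoid_prob q (from j) = j%:R / n.+1%:R.
Proof.
move=> Lc fromE; rewrite avoid_q fromE.
case: j => [|j] jn.
  rewrite mul0r -fromE -avoid//.
  rewrite (_ : mkset _ = set0) ?measure0//; apply/seteqP; split => w //=.
  by move=> /(_ 0%N); rewrite fromE /=.
move: jn; rewrite leq_eqVlt => /orP[/eqP jn|jn].
  rewrite jn divff// -avoid -?fromE//.
  rewrite (_ : mkset _ = setT) ?probability_setT//; apply/seteqP; split => w //= _ i.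
  by rewrite fromE/= => /leq_ltn_trans/(_ (ltn_level _ _)); rewrite ltnn.
have p01 : 0 < (j.+1%:R / n.+1%:R : R) < 1.
  by rewrite divr_gt0//= ltr_pdivrMr// mul1r ltr_nat.
rewrite (_ : mkset _ = [set x | frechet_inv (j.+1%:R / n.+1%:R) <= c x]); last first.
  by apply/seteqP; split => x /=; rewrite le_levelE.
rewrite Lc ?frechet_inv_gt0//= invrK opprK lnK// posrE.
by case/andP: p01.
Qed.

Let tie_le : \sum_D1 \sum_D2 q D1 * q D2 * (tie D1 D2)%:R <= n.+1%:R^-1 + n.+1%:R^-1.
Proof.
have step (from : nat -> {set cell}) (c : R * R -> R) (top : {set cell} -> nat) :
    (forall t, 0 < t -> Lambda [set x | t <= c x] = (t^-1)%:E) ->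
    (forall j, cells (from j) = [set x | (j <= level n (c x))%N]) ->
    (forall j, \sum_D q D * (top D == j)%:R =
       avoid_prob q (from j.+1) - avoid_prob q (from j)) ->
    (forall D, (top D <= n)%N) ->
    forall j, \sum_D q D * (top D == j)%:R <= n.+1%:R^-1.
  move=> Lc fromE topE topn j; have [jn|jn] := leqP j n; last first.
    rewrite big1 ?invr_ge0// => D _.
    by rewrite ltn_eqF ?mulr0//; exact: leq_ltn_trans jn.
  rewrite topE !(avoid_from Lc fromE)//; last exact: leqW.
  by rewrite -mulrBl -natr1 addrAC subrr add0r mul1r.
apply: tie_prob_le => //.
- by move=> D; exact: occupied_prob_ge0.
- apply: (step (@from1 _) fst) => //.
  + by move=> j; apply/seteqP; split => x; rewrite /cells /= inE gcell1.
  + by move=> j; apply: prob_top1 => D; exact: occupied_prob0.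
  + by move=> D; apply/bigmax_leqP => c _; rewrite -ltnS ltn_ord.
- apply: (step (@from2 _) snd) => //.
  + by move=> j; apply/seteqP; split => x; rewrite /cells /= inE gcell2.
  + by move=> j; apply: prob_top2 => D; exact: occupied_prob0.
  + by move=> D; apply/bigmax_leqP => c _; rewrite -ltnS ltn_ord.
Qed.

Lemma grid_sign_concurrence :
  `| \sum_D1 \sum_D2 q D1 * q D2 * sign_product D1 D2
     - \int[P]_w (concurrent (occupied n (phi2 ^~ w)))%:R | <= n.+1%:R^-1 + n.+1%:R^-1.
Proof.
rewrite -(occupied_prob_mean _ mphi2 (fun D => (concurrent D)%:R)).
apply: le_trans tie_le; apply: sign_product_mean => //.
- by move=> D; exact: occupied_prob_ge0.
- by move=> D; exact: occupied_prob0.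
Qed.

End fixed_grid.

Let ae_maximum : {ae P, forall w,
  [/\ forall i, (phi i w).1 <= eta s1 w, exists i, (phi i w).1 = eta s1 w,
      forall i, (phi i w).2 <= eta s2 w & exists i, (phi i w).2 = eta s2 w]}.
Proof.
have [_ _ _ [_]] := heta; apply: filterS => w h.
have [[i1 _ E1] u1] := h s1 Xs1; have [[i2 _ E2] u2] := h s2 Xs2.
split; [| by exists i1 | | by exists i2].
- by move=> i; apply: u1; exists i.
- by move=> i; apply: u2; exists i.
Qed.

Let measurable_ge1 (t : R) : measurable [set x : R * R | t <= x.1].
Proof.
rewrite (_ : mkset _ = fst @^-1` `[t, +oo[%classic).
  by rewrite -[X in measurable X]setTI; exact: measurable_fst.
by apply/seteqP; split => x /=; rewrite in_itv/= andbT.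
Qed.

(** The chance of no point with first coordinate at least [m.+1%:R^-1] is [expR (- m.+1%:R)], which
    is at most [m.+1%:R^-1], for every [m]. *)
Let ae_positive : {ae P, forall w, exists i, 0 < (phi i w).1}.
Proof.
have mpos : measurable [set x : R * R | 0 < x.1].
  rewrite (_ : mkset _ = fst @^-1` `]0, +oo[%classic).
    by rewrite -[X in measurable X]setTI; exact: measurable_fst.
  by apply/seteqP; split => x /=; rewrite in_itv/= andbT.
have mpre A i : measurable A -> measurable (phi i @^-1` A).
  by move=> mA; rewrite -[X in measurable X]setTI; exact: mphi.
have mav A : measurable A -> measurable [set w | forall i, ~ A (phi i w)].
  move=> mA; rewrite (_ : mkset _ = \bigcap_i ~` (phi i @^-1` A)).
    by apply: bigcapT_measurable => i; apply: measurableC; exact: mpre.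
  by apply/seteqP; split => w /= h i; [move=> _; exact: h|exact: (h i)].
pose N := [set w | forall i, ~ [set x : R * R | 0 < x.1] (phi i w)].
have PN m : (P N <= (m.+1%:R^-1)%:E)%E.
  have m0 : 0 < m.+1%:R^-1 :> R by rewrite invr_gt0.
  apply: (@le_trans _ _ (P [set w | forall i, ~ [set x | m.+1%:R^-1 <= x.1] (phi i w)])).
    apply: le_measure; rewrite ?inE; [exact: mav|by apply: mav|].
    by move=> w /= h i mw; apply: (h i); exact: lt_le_trans mw.
  rewrite avoid// Lambda_ge1// invrK/= lee_fin expRN lef_pV2 ?posrE ?expR_gt0//.
  by apply: le_trans (expR_ge1Dx _); rewrite lerDr.
exists N; split => //; first exact: mav.
  apply/eqP; rewrite eq_le measure_ge0 andbT.
  rewrite -[leLHS]fineK ?fin_num_measure//; last exact: mav.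
  rewrite lee_fin leNgt; apply/negP => p0.
  have := PN (Num.truncn (fine (P N))^-1).
  rewrite -[leLHS]fineK ?fin_num_measure//; last exact: mav.
  rewrite lee_fin leNgt => /negP; apply.
  by rewrite invf_plt ?posrE// truncnS_gt.
by move=> w /= h i i0; apply: h; exists i.
Qed.

Let ae_finite : {ae P, forall w, forall m, finite_set [set i | m.+1%:R^-1 <= (phi i w).1]}.
Proof.
apply: ae_foralln => m.
apply: (finitely_many_hits Xs1 Xs2 mY hzeta hYi hind (A := [set x | m.+1%:R^-1 <= x.1])) => //.
by rewrite -/Lambda Lambda_ge1 ?invr_gt0// ltry.
Qed.

Let concur := [set w | exists l, eta s1 w = (phi l w).1 /\ eta s2 w = (phi l w).2].

Let mset_eq (f g : T -> R) : measurable_fun setT f -> measurable_fun setT g ->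
  measurable [set w | f w = g w].
Proof.
move=> mf mg; rewrite (_ : mkset _ = (f \- g) @^-1` [set 0]).
  by rewrite -[X in measurable X]setTI; apply: measurable_funB.
by apply/seteqP; split => w /= => [->|/eqP]; [rewrite subrr|rewrite subr_eq0 => /eqP].
Qed.

Let measurable_concur : measurable concur.
Proof.
rewrite (_ : concur = \bigcup_l ([set w | eta s1 w = (phi l w).1] `&`
                                 [set w | eta s2 w = (phi l w).2])).
  apply: bigcupT_measurable => l; apply: measurableI; apply: mset_eq; try exact: meta.
    exact: (measurableT_comp measurable_fst (mphi l)).
  exact: (measurableT_comp measurable_snd (mphi l)).
by apply/seteqP; split => w /= [l]; [exists l|exists l].
Qed.

Let double_top n w :
  [/\ forall i, (phi i w).1 <= eta s1 w, exists i, (phi i w).1 = eta s1 w,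
      forall i, (phi i w).2 <= eta s2 w & exists i, (phi i w).2 = eta s2 w] ->
  concurrent (occupied n (phi2 ^~ w)) = `[< exists i,
    level n (2 * (phi i w).1) = level n (2 * eta s1 w) /\
    level n (2 * (phi i w).2) = level n (2 * eta s2 w) >].
Proof.
move=> [u1 [i1 E1] u2 [i2 E2]]; apply: concurrent_occupied.
  apply: top1_occupied => [i|]; first by rewrite /phi2 /= ler_pM2l ?u1.
  by exists i1; rewrite -E1.
apply: top2_occupied => [i|]; first by rewrite /phi2 /= ler_pM2l ?u2.
by exists i2; rewrite -E2.
Qed.

(** Concurrence persists on every grid. Without it, each point is strictly below the maximum in some
    coordinate and is separated from it on fine grids. The separation is uniform: finitely many
    points are above a threshold smaller than [eta s1 w], and all others are excluded by the level
    of the threshold. *)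
Let cvg_concurrent :
  {ae P, forall w, (concurrent (occupied n (phi2 ^~ w)))%:R @[n --> \oo] --> (\1_concur w : R)}.
Proof.
apply: filterS3 ae_maximum ae_positive ae_finite => w wmax [j j0] wfin.
have topE n := double_top n wmax; have [u1 [i1 E1] u2 [i2 E2]] := wmax.
apply: cvg_near_cst; rewrite indicE.
have [[l [l1 l2]]|wN] := pselect (concur w).
  rewrite mem_set//; last by exists l.
  by apply: nearW => n; rewrite topE asboolT//; exists l; rewrite l1 l2.
rewrite memNset//.
have e0 : 0 < eta s1 w by apply: lt_le_trans j0 (u1 j).
(* The threshold [m.+1%:R^-1] must lie strictly below the positive maximum [eta s1 w]. *)
pose m := Num.truncn ((eta s1 w)^-1).
have m_lt : m.+1%:R^-1 < eta s1 w.
  by rewrite -[ltRHS]invrK ltf_pV2 ?posrE ?invr_gt0// truncnS_gt.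
have [s sE] := (finite_seqP _).1 (wfin m).
pose at_top n i := (level n (2 * (phi i w).1) == level n (2 * eta s1 w)) &&
  (level n (2 * (phi i w).2) == level n (2 * eta s2 w)).
have sep i : \forall n \near \oo, ~~ at_top n i.
  rewrite /at_top.
  have [p1 p2] := phi_ge0 i w.
  have := u1 i; rewrite le_eqVlt => /orP[/eqP i1E|lt1]; last first.
    have : 2 * (phi i w).1 < 2 * eta s1 w by rewrite ltr_pM2l.
    move=> /lt_level-/(_ (mulr_ge0 (ler0n _ _) p1)); apply: filterS => n /ltn_eqF ->.
    by [].
  have := u2 i; rewrite le_eqVlt => /orP[/eqP i2E|lt2]; last first.
    have : 2 * (phi i w).2 < 2 * eta s2 w by rewrite ltr_pM2l.
    move=> /lt_level-/(_ (mulr_ge0 (ler0n _ _) p2)); apply: filterS => n /ltn_eqF ->.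
    by rewrite andbF.
  by exfalso; apply: wN; exists i; rewrite i1E i2E.
have seps : \forall n \near \oo, all (fun i => ~~ at_top n i) s.
  elim: s {sE} => [|i s IH]; first exact: nearW.
  by apply: filterS2 (sep i) IH => n /= -> ->.
have small : \forall n \near \oo, (level n (2 * m.+1%:R^-1 : R) < level n (2 * eta s1 w))%N.
  have h0 : 0 <= 2 * m.+1%:R^-1 :> R by rewrite mulr_ge0// invr_ge0.
  by apply: (lt_level h0); rewrite ltr_pM2l.
apply: filterS2 seps small => n /allP ns nsmall.
rewrite topE asboolF// => -[i [h1 h2]].
have [im|im] := leP (m.+1%:R^-1) (phi i w).1.
  have := ns i; rewrite /at_top h1 h2 !eqxx => /(_ _)/negP; apply => //.
  have : [set i | m.+1%:R^-1 <= (phi i w).1] i by [].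
  by rewrite sE.
move: nsmall; rewrite -h1 ltnNge => /negP; apply.
by apply: le_level; rewrite ler_pM2l// ltW.
Qed.

Let measurable_concurrent n :
  measurable_fun setT (fun w => (concurrent (occupied n (phi2 ^~ w)))%:R : R).
Proof.
apply: (measurable_finite_valued (fun D => (concurrent D)%:R)).
by move=> D; apply: measurable_occupied; exact: mphi2.
Qed.

Lemma cvg_concurrence :
  \int[P]_w (concurrent (occupied n (phi2 ^~ w)))%:R @[n --> \oo] --> fine (P concur).
Proof.
rewrite -Rintegral_indic//.
apply: (@bounded_cvg_Rintegral _ _ _ _ _ _ 1) => //.
by move=> n w; case: (concurrent _); rewrite ?normr1 ?normr0.
Qed.

Let eta_pair w := (eta s1 w, eta s2 w).
Let eta'_pair w := (eta' s1 w, eta' s2 w).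

Let meta_pair : measurable_fun setT eta_pair.
Proof. by apply: measurable_fun_pair; exact: meta. Qed.

Let meta'_pair : measurable_fun setT eta'_pair.
Proof. by apply: measurable_fun_pair; exact: meta'. Qed.

Let gcell_law n c :
  P [set w | gcell n (eta'_pair w) = c] = P [set w | gcell n (eta_pair w) = c].
Proof.
have [_ law _] := heta'.
apply: (same_law_pair (A := [set x | gcell n x = c]) meta' meta Xs1 Xs2 law).
rewrite (_ : mkset _ = [set x | gcell n x == c]).
  exact: (measurable_gcell (pred1 c)).
by apply/seteqP; split => x /= /eqP.
Qed.

(** The cell events belong to the generated sigma-algebras, and by equality in law both factors can
    be expressed with [eta]. *)
Let gcell_independent n a b :
  P [set w | gcell n (eta_pair w) = a /\ gcell n (eta'_pair w) = b] =
  (P [set w | gcell n (eta_pair w) = a] * P [set w | gcell n (eta_pair w) = b])%E.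
Proof.
have [_ _ ind] := heta'; rewrite -(gcell_law b).
have mc (c : 'I_n.+1 * 'I_n.+1) : measurable [set x : R * R | gcell n x = c].
  rewrite (_ : mkset _ = [set x | gcell n x == c]).
    exact: (measurable_gcell (pred1 c)).
  by apply/seteqP; split => x /= /eqP.
have fam (Z : 'rV[R]_k -> T -> R) c :
    sigma_family X Z [set w | gcell n (Z s1 w, Z s2 w) = c].
  have mZ : measurable_fun setT ((fun w => (Z s1 w, Z s2 w)) : g_sigma_algebraType
    (\bigcup_(s in X) preimage_set_system setT (Z s) measurable) -> R * R).
    by apply: measurable_fun_pair; exact: (@measurable_sigma_family d T _ _ _ X Z).
  by have := mZ measurableT _ (mc c); rewrite setTI.
by rewrite -ind; [|exact: fam|exact: fam].
Qed.

Let grid_sign n w : R :=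
  Num.sg ((level n (eta s1 w))%:R - (level n (eta' s1 w))%:R) *
  Num.sg ((level n (eta s2 w))%:R - (level n (eta' s2 w))%:R).

Let mgcell n (f : T -> R * R) (c : 'I_n.+1 * 'I_n.+1) : measurable_fun setT f ->
  measurable [set w | gcell n (f w) = c].
Proof.
move=> mf; rewrite (_ : mkset _ = f @^-1` [set x | gcell n x == c]).
  rewrite -[X in measurable X]setTI; apply: mf => //.
  exact: (measurable_gcell (pred1 c)).
by apply/seteqP; split => x /= /eqP.
Qed.

Let G n (a b : 'I_n.+1 * 'I_n.+1) : R :=
  Num.sg ((a.1 : nat)%:R - (b.1 : nat)%:R) * Num.sg ((a.2 : nat)%:R - (b.2 : nat)%:R).

Let grid_signE n : grid_sign n = fun w => G (gcell n (eta_pair w)) (gcell n (eta'_pair w)).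
Proof. by apply/funext => w; rewrite /grid_sign /G !gcell1 !gcell2. Qed.

Let mpair_cell n (c : ('I_n.+1 * 'I_n.+1) * ('I_n.+1 * 'I_n.+1)) :
  measurable [set w | (gcell n (eta_pair w), gcell n (eta'_pair w)) = c].
Proof.
case: c => a b; rewrite (_ : mkset _ = [set w | gcell n (eta_pair w) = a] `&`
    [set w | gcell n (eta'_pair w) = b]).
  by apply: measurableI; apply: mgcell.
by apply/seteqP; split => w /= [-> ->].
Qed.

Let measurable_grid_sign n : measurable_fun setT (grid_sign n).
Proof.
rewrite grid_signE.
exact: (measurable_finite_valued (Z := fun w => (gcell n (eta_pair w), gcell n (eta'_pair w)))
  (fun c => G c.1 c.2) (@mpair_cell n)).
Qed.

Let topcell n (D : {set 'I_n.+1 * 'I_n.+1}) : 'I_n.+1 * 'I_n.+1 :=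
  (inord (top1 D), inord (top2 D)).

Let topcellE n (D1 D2 : {set 'I_n.+1 * 'I_n.+1}) :
  G (topcell D1) (topcell D2) = sign_product D1 D2.
Proof.
rewrite /G /sign_product /= !inordK//; rewrite ltnS;
by apply/bigmax_leqP => c _; rewrite -ltnS ltn_ord.
Qed.

(** Almost surely the cell of the pair of maxima is the crossing of the top column and top row of
    the occupied set, whether or not that cell is occupied. *)
Let gcell_mean n (g : 'I_n.+1 * 'I_n.+1 -> R) :
  \sum_a fine (P [set w | gcell n (eta_pair w) = a]) * g a =
  \sum_D occupied_prob P phi D * g (topcell D).
Proof.
rewrite (occupied_prob_mean _ mphi (fun D => g (topcell D))).
rewrite -(@Rintegral_finite_valued _ _ _ P _ (fun w => gcell n (eta_pair w))); last first.
  by move=> c; exact: mgcell.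
rewrite /Rintegral; congr fine; apply: ae_eq_integral => //.
- apply/measurable_EFinP; apply: (measurable_finite_valued g) => c; exact: mgcell.
- apply/measurable_EFinP; apply: (measurable_finite_valued (fun D => g (topcell D))) => D.
  by apply: measurable_occupied; exact: mphi.
- apply: filterS ae_maximum => w [u1 [i1 E1] u2 [i2 E2]] _; congr (g _)%:E.
  rewrite /topcell (@top1_occupied _ _ _ (eta s1 w)) ?(@top2_occupied _ _ _ (eta s2 w))//.
  - by exists i2.
  - by exists i1.
Qed.

(** The pair of cells has a product law with equal factors, so [gcell_mean] applies in each variable
    in turn. *)
Lemma grid_sign_mean n : \int[P]_w grid_sign n w =
  \sum_(D1 : {set 'I_n.+1 * 'I_n.+1}) \sum_(D2 : {set 'I_n.+1 * 'I_n.+1})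
    occupied_prob P phi D1 * occupied_prob P phi D2 * sign_product D1 D2.
Proof.
rewrite grid_signE.
rewrite (@Rintegral_finite_valued _ _ _ P _
  (fun w => (gcell n (eta_pair w), gcell n (eta'_pair w))) (fun c => G c.1 c.2));
  last exact: mpair_cell.
pose p a := fine (P [set w | gcell n (eta_pair w) = a]).
transitivity (\sum_a \sum_b p a * (p b * G a b)).
  rewrite pair_big/=; apply: eq_bigr => -[a b] _ /=; rewrite mulrA; congr (_ * _).
  rewrite (_ : mkset _ = [set w | gcell n (eta_pair w) = a /\ gcell n (eta'_pair w) = b]).
    by rewrite gcell_independent fineM// fin_num_measure//; exact: mgcell.
  by apply/seteqP; split => w /= [-> ->].
under eq_bigr do rewrite -mulr_sumr gcell_mean.
rewrite (gcell_mean (fun a => \sum_D occupied_prob P phi D * G a (topcell D))).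
apply: eq_bigr => D1 _; rewrite mulr_sumr; apply: eq_bigr => D2 _.
by rewrite topcellE mulrA.
Qed.

Let kendall_sign w : R := Num.sg (eta s1 w - eta' s1 w) * Num.sg (eta s2 w - eta' s2 w).

(** The separation of levels requires nonnegative values. For [eta] they come from the spectral
    functions; [eta'] inherits them through its law. *)
Let ae_nonneg : {ae P, forall w,
  [/\ 0 <= eta s1 w, 0 <= eta' s1 w, 0 <= eta s2 w & 0 <= eta' s2 w]}.
Proof.
pose A := [set x : R * R | x.1 < 0 \/ x.2 < 0].
have mA : measurable A.
  rewrite (_ : A = fst @^-1` `]-oo, 0[%classic `|` snd @^-1` `]-oo, 0[%classic).
    apply: measurableU; rewrite -[X in measurable X]setTI.
      by apply: measurable_fst.
    by apply: measurable_snd.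
  by apply/seteqP; split => x /=; rewrite !in_itv.
have eta0 : {ae P, forall w, ~ A (eta_pair w)}.
  apply: filterS ae_maximum => w [_ [i1 E1] _ [i2 E2]].
  have [p1 _] := phi_ge0 i1 w; have [_ p2] := phi_ge0 i2 w.
  by rewrite /A/= -E1 -E2 => -[]; rewrite ltNge ?p1 ?p2.
have mAeta : measurable [set w | A (eta_pair w)].
  by rewrite -[X in measurable X]setTI; exact: meta_pair.
have mAeta' : measurable [set w | A (eta'_pair w)].
  by rewrite -[X in measurable X]setTI; exact: meta'_pair.
have P0 : P [set w | A (eta_pair w)] = 0%E.
  apply: measure_negligible => //.
  by move: eta0; rewrite /almost_everywhere/=; congr (_.-negligible _);
    apply/seteqP; split => w /=; [move/contrapT|move=> Aw /(_ Aw)].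
have [_ law _] := heta'.
have eta'0 : {ae P, forall w, ~ A (eta'_pair w)}.
  exists [set w | A (eta'_pair w)]; split => //.
    by rewrite (same_law_pair (A := A) meta' meta Xs1 Xs2 law).
  by move=> w /= /contrapT.
apply: filterS2 eta0 eta'0 => w; rewrite /A/= => n1 n2.
by split; rewrite leNgt; apply/negP => lt0; [apply: n1|apply: n2|apply: n1|apply: n2]; auto.
Qed.

Let cvg_sg_level (x y : R) : 0 <= x -> 0 <= y ->
  \forall n \near \oo, Num.sg ((level n x)%:R - (level n y)%:R) = Num.sg (x - y) :> R.
Proof.
move=> x0 y0; case: (ltgtP x y) => [xy|yx|->].
- apply: filterS (lt_level x0 xy) => n nxy.
  by rewrite !ltr0_sg// subr_lt0// ltr_nat.
- apply: filterS (lt_level y0 yx) => n nyx.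
  by rewrite !gtr0_sg// subr_gt0// ltr_nat.
- by apply: nearW => n; rewrite !subrr.
Qed.

Let cvg_grid_sign : {ae P, forall w, grid_sign n w @[n --> \oo] --> kendall_sign w}.
Proof.
apply: filterS ae_nonneg => w [a1 b1 a2 b2]; apply: cvg_near_cst.
by apply: filterS2 (cvg_sg_level a1 b1) (cvg_sg_level a2 b2) => n; rewrite /grid_sign => -> ->.
Qed.

Let norm_sg_le1 (x y : R) : `|Num.sg x * Num.sg y| <= 1.
Proof. by rewrite normrM !normr_sg -natrM; case: (_ != _); case: (_ != _). Qed.

Let measurable_kendall : measurable_fun setT kendall_sign.
Proof.
have msg (f : T -> R) : measurable_fun setT f -> measurable_fun setT (fun w => Num.sg (f w)).
  move=> mf; rewrite (_ : (fun w => _) =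
    fun w => \1_(f @^-1` `]0, +oo[%classic) w - \1_(f @^-1` `]-oo, 0[%classic) w).
    by apply: measurable_funB; apply: measurable_indic;
      rewrite -[X in measurable X]setTI; apply: mf.
  apply/funext => w; rewrite !indicE.
  have -> : (w \in f @^-1` `]0, +oo[%classic) = (0 < f w).
    by apply/idP/idP; rewrite inE/= in_itv/= andbT.
  have -> : (w \in f @^-1` `]-oo, 0[%classic) = (f w < 0).
    by apply/idP/idP; rewrite inE/= in_itv.
  case: (ltgtP (f w) 0) => [f0|f0|->].
  - by rewrite ltr0_sg// sub0r.
  - by rewrite gtr0_sg// subr0.
  - by rewrite sgr0 subrr.
by apply: measurable_funM; apply: msg; apply: measurable_funB;
  [exact: meta|exact: meta'|exact: meta|exact: meta'].
Qed.

Lemma cvg_kendall : \int[P]_w grid_sign n w @[n --> \oo] --> \int[P]_w kendall_sign w.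
Proof.
by apply: (@bounded_cvg_Rintegral _ _ _ _ _ _ 1) => // n w; exact: norm_sg_le1.
Qed.

(** On the grid of index [n] the two quantities differ by at most [2 / n.+1], and each converges to
    its continuous counterpart. *)
Lemma concurrence_kendall :
  concurrence_probability P (spectral_functions zeta Yi) eta s1 s2 =
  kendall_tau P eta eta' s1 s2.
Proof.
have E : fine (P concur) = \int[P]_w kendall_sign w.
  apply/eqP; rewrite -subr_eq0 -normr_le0.
  have cdiff : `|\int[P]_w grid_sign n w - \int[P]_w (concurrent (occupied n (phi2 ^~ w)))%:R|
      @[n --> \oo] --> `|\int[P]_w kendall_sign w - fine (P concur)|.
    by apply: cvg_norm; apply: cvgB; [exact: cvg_kendall|exact: cvg_concurrence].
  have c0 : (n.+1%:R^-1 + n.+1%:R^-1 : R) @[n --> \oo] --> (0 + 0 : R).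
    by apply: cvgD; exact: cvg_harmonic.
  rewrite distrC -(cvg_lim _ cdiff)// -[0 in leRHS]addr0 -(cvg_lim _ c0)//.
  apply: ler_lim; [by apply/cvg_ex; eexists; exact: cdiff|by apply/cvg_ex; eexists; exact: c0|].
  by apply: nearW => n; rewrite grid_sign_mean; exact: grid_sign_concurrence.
rewrite /kendall_tau unlock -[RHS]fineK; last first.
  apply: integrable_fin_num => //.
  by apply: (bounded_integrable _ (M := 1)) => // w; exact: norm_sg_le1.
rewrite /concurrence_probability -[LHS]fineK; last by rewrite fin_num_measure.
by congr EFin.
Qed.

End concurrence.

Unset Implicit Arguments.

Theorem theorem4 (R : realType) (k : nat) (hk : (1 <= k)%N)
  (X : set 'rV[R]_k) (hX : compact X)
  (dQ : measure_display) (TQ : measurableType dQ) (Q : probability TQ R)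
  (Y : 'rV[R]_k -> TQ -> R) (hY : spectral_process Q X Y)
  (d : measure_display) (T : measurableType d) (P : probability T R)
  (zeta : nat -> T -> R) (Yi : nat -> 'rV[R]_k -> T -> R)
  (eta eta' : 'rV[R]_k -> T -> R)
  (heta : spectral_representation P X Q Y zeta Yi eta)
  (heta' : independent_copy P X eta eta')
  (s1 s2 : 'rV[R]_k) (hs1 : X s1) (hs2 : X s2) :
  concurrence_probability P (spectral_functions zeta Yi) eta s1 s2
  = kendall_tau P eta eta' s1 s2.
Proof. exact: (concurrence_kendall hY heta heta' hs1 hs2). Qed.
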